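(* Let $p\ge1$, $T>0$, $\varepsilon>0$, $0<\delta<1$, $\omega>\Lambda>0$, $z\in(0,1)$ and let $n$ be a positive integer with $n\ge\frac{\omega T}{\pi\sqrt z}$. Let $\varphi$ be an Orlicz N-function satisfying Condition Q, with density $f$ and Young-Fenchel transform $\varphi^*$. Let $\mathbf X(t)$, $t\in\mathbb R$, be a stationary $SSub_\varphi(\Omega)$ process with determinative constant $C_{\mathbf X}$, whose spectrum is bandlimited to $[-\Lambda,\Lambda)$, let $\mathbf X_n(t)$ be its truncated sampling sum with parameter $\omega$, and let $$S_{n,p}:=\left(\frac{C_{\mathbf X}}{n}\right)^p\int_0^T C_n^{p/2}(t)\,dt,\qquad C_n(t):=\mathbf B(0)\cdot\left(\frac{4\omega t}{\pi^2(1-z)}+\frac{4\left(z+1+\frac1n\right)}{\pi(1-z)^2\left(1-\frac{\Lambda}{\omega}\right)}\right)^2 .$$ Then $\mathbf X_n$ approximates $\mathbf X$ in $L_p([0,T])$ with accuracy $\varepsilon$ and reliability $1-\delta$ if the following two inequalities hold: $$\varepsilon>S_{n,p}\cdot\left(f\left(p\,(S_{n,p}/\varepsilon)^{1/p}\right)\right)^p,\qquad \exp\left\{-\varphi^*\left(\left(\varepsilon/S_{n,p}\right)^{1/p}\right)\right\}\le\delta/2 .$$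
   Context: $\mathbf X_n$ approximates $\mathbf X$ in $L_p([0,T])$ with accuracy $\varepsilon>0$ and reliability $1-\delta$, $0<\delta<1$, if $\mathbf P\left\{\int_0^T|\mathbf X(t)-\mathbf X_n(t)|^p\,dt>\varepsilon\right\}\le\delta$. Orlicz N-function: a continuous even convex function $\varphi:\mathbb R\to\mathbb R$, monotonically increasing for $x>0$, with $\varphi(0)=0$, $\varphi(x)/x\to0$ as $x\to0$ and $\varphi(x)/x\to\infty$ as $x\to\infty$. Condition Q: $\lim_{x\to0}\varphi(x)/x^2=C>0$, where $C=+\infty$ is allowed. Young-Fenchel transform: $\varphi^*(x):=\sup_{y\in\mathbb R}(xy-\varphi(y))$. Density: $\varphi$ can be written as $\varphi(u)=\int_0^{|u|}f(v)\,dv$ with $f$ monotonically non-decreasing, right-continuous, $f(0)=0$ and $f(x)\to+\infty$ as $x\to+\infty$; this $f$ is the density of $\varphi$. A zero-mean random variable $\xi$ on a standard probability space belongs to $Sub_\varphi(\Omega)$ if there is a constant $a_\xi\ge0$ with $\mathbf E\exp(\lambda\xi)\le\exp(\varphi(a_\xi\lambda))$ for all $\lambda\in\mathbb R$. Its norm is $\tau_\varphi(\xi):=\sup_{\lambda\ne0}\varphi^{(-1)}(\ln\mathbf E\exp\{\lambda\xi\})/|\lambda|$, where $\varphi^{(-1)}$ is the inverse function of $\varphi$ (restricted to $[0,\infty)$). A process $\mathbf X(t)$ is an $SSub_\varphi(\Omega)$ (strictly $Sub_\varphi(\Omega)$) process with determinative constant $C_{\mathbf X}>0$ if every $\mathbf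 X(t)\in Sub_\varphi(\Omega)$ and, for all finite collections of time points $t_i$ and reals $\lambda_i$, $i\in I$, $\tau_\varphi\left(\sum_{i\in I}\lambda_i\mathbf X(t_i)\right)\le C_{\mathbf X}\left(\mathbf E\left(\sum_{i\in I}\lambda_i\mathbf X(t_i)\right)^2\right)^{1/2}$. A zero-mean stationary process has spectrum bandlimited to $[-\Lambda,\Lambda)$ if $\mathbf B(\tau):=\mathbf E\,\mathbf X(t+\tau)\mathbf X(t)=\int_{-\Lambda}^{\Lambda}e^{i\tau\lambda}\,dF(\lambda)$ with $F$ its spectral function. The truncated sampling sum is $$\mathbf X_n(t):=\sum_{k=-n}^n\frac{\sin\left(\omega\left(t-\frac{k\pi}{\omega}\right)\right)}{\omega\left(t-\frac{k\pi}{\omega}\right)}\,\mathbf X\left(\frac{k\pi}{\omega}\right),$$ where $\sin(x)/x$ is understood as $1$ at $x=0$. *)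

(* Defs.v *)
From mathcomp Require Export all_boot all_order all_algebra.
From mathcomp Require Export all_classical all_reals all_analysis.

Set Implicit Arguments.
Unset Strict Implicit.
Unset Printing Implicit Defensive.

Export Order.TTheory GRing.Theory Num.Theory.
Export numFieldNormedType.Exports.

Local Open Scope classical_set_scope.
Local Open Scope ring_scope.

Definition N_function (R : realType) (phi : R -> R) : Prop :=
  continuous phi /\
  (forall x, phi (- x) = phi x) /\
  convex_function [set: R^o] phi /\
  {in `]0, +oo[ &, {homo phi : x y / x < y}} /\
  phi 0 = 0 /\
  phi x / x @[x --> 0^'] --> 0 /\
  phi x / x @[x --> +oo] --> +oo.

Definition condition_Q (R : realType) (phi : R -> R) : Prop :=
  exists C : \bar R, (0 < C)%E /\ (phi x / x ^+ 2)%:E @[x --> 0^'] --> C.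

(* A real-valued supremum: for an N-function the set below is nonempty and
   bounded above at every x, since phi y / y tends to +oo. *)
Definition young_fenchel (R : realType) (phi : R -> R) (x : R) : R :=
  sup [set x * y - phi y | y in [set: R]].

Definition is_density (R : realType) (phi f : R -> R) : Prop :=
  {in `[0, +oo[ &, {homo f : x y / x <= y}} /\
  (forall x, 0 <= x -> f y @[y --> x^'+] --> f x) /\
  f 0 = 0 /\
  f x @[x --> +oo] --> +oo /\
  (forall u, phi u = \int[lebesgue_measure]_(v in `[0, `|u|]) f v).

Section processes.
Context (R : realType) (d : measure_display) (Omega : measurableType d).
Context (P : probability Omega R).

Definition Sub (phi : R -> R) (xi : Omega -> R) : Prop :=
  ('E_P[xi] = 0)%E /\
  exists a : R, 0 <= a /\
    forall l : R,
      ('E_P[fun w => expR (l * xi w)] <= (expR (phi (a * l)))%:E)%E.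

(* [pinv `[0, +oo[ phi] is the inverse of the restriction of phi to [0, +oo[.
   The expectation below is finite whenever xi is in [Sub phi], so taking its
   logarithm through [fine] loses nothing there. *)
Definition tau_norm (phi : R -> R) (xi : Omega -> R) : \bar R :=
  ereal_sup
    [set (pinv (`[0, +oo[ : set R) phi (ln (fine 'E_P[fun w => expR (l * xi w)]%E))
           / `|l|)%:E | l in [set l : R | l != 0]].

(* The second moment is finite for linear combinations of Sub variables. *)
Definition SSub (phi : R -> R) (X : R -> {RV P >-> R}) (C : R) : Prop :=
  0 < C /\
  (forall t, Sub phi (X t)) /\
  forall (m : nat) (t l : 'I_m -> R),
    let Y w := \sum_(i < m) l i * X (t i) w in
    (tau_norm phi Y <= (C * Num.sqrt (fine 'E_P[fun w => (Y w ^+ 2)%R]%E))%:E)%E.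

(* Wide-sense stationarity, with covariance function B. *)
Definition stationary (X : R -> {RV P >-> R}) (B : R -> R) : Prop :=
  (forall t, ('E_P[X t] = 0)%E) /\
  forall t tau, ('E_P[fun w => (X (t + tau) w * X t w)%R] = (B tau)%:E)%E.

(* B tau is the integral of e^{i tau l} dF(l) over [-L, L[, written through its
   real and imaginary parts; B is real-valued. *)
Definition bandlimited (B : R -> R) (L : R) : Prop :=
  exists F : cumulative R R, forall tau : R,
    \int[lebesgue_stieltjes_measure F]_(l in `[- L, L[) cos (tau * l) = B tau /\
    \int[lebesgue_stieltjes_measure F]_(l in `[- L, L[) sin (tau * l) = 0.

Definition sinc (x : R) : R := if x == 0 then 1 else sin x / x.

(* The index j runs over 0, ..., 2n and stands for k = j - n. *)
Definition trunc_sampling (X : R -> {RV P >-> R}) (om : R) (n : nat)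
    (t : R) (w : Omega) : R :=
  \sum_(j < (2 * n).+1)
    let k : R := j%:R - n%:R in
    sinc (om * (t - k * pi / om)) * X (k * pi / om) w.

(* Joint measurability on [0, T] x Omega: it makes the integrals over [0, T] of
   the paths well defined and random variables. *)
Definition measurable_process (X : R -> {RV P >-> R}) (T : R) : Prop :=
  measurable_fun (`[0, T] `*` [set: Omega]) (fun z : R * Omega => X z.1 z.2).

Definition approximates_Lp (X Y : R -> Omega -> R) (p T eps delta : R) : Prop :=
  (P [set w | (eps%:E <
        \int[lebesgue_measure]_(t in `[0%R, T]) (`|X t w - Y t w| `^ p)%:E)%E]
   <= delta%:E)%E.

End processes.

Definition C_n (R : realType) (B : R -> R) (om L z : R) (n : nat) (t : R) : R :=
  B 0 * (4 * om * t / (pi ^+ 2 * (1 - z)) +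
         4 * (z + 1 + n%:R^-1) / (pi * (1 - z) ^+ 2 * (1 - L / om))) ^+ 2.

Definition S_np (R : realType) (C : R) (B : R -> R) (om L z T p : R) (n : nat)
    : R :=
  (C / n%:R) `^ p *
  \int[lebesgue_measure]_(t in `[0, T]) (C_n B om L z n t `^ (p / 2)).

(* Main.v *)
From mathcomp Require Import ring lra measurable_realfun.
Require Import Defs.

(** Put [u = om t / pi] and [th = pi lam / om]. The partial sums of
    [sum_k sinc (pi (u - k)) e^(i k th)] differ from [e^(i u th)] by integrals of
    the Dirichlet kernel against smooth functions, which tend to 0 as long as
    [|th| < pi]. The error after [|k| <= n] is therefore the tail [|k| > n];
    pairing [k] with [-k] bounds its real part by a multiple of
    [sum_(k > n) 1 / k^2], and Abel summation bounds its imaginary part, by the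
    boundedness of the partial sums of [(-1)^k sin (k th)]. Integrated against the
    spectral measure, this gives [E (X t - X_n t)^2 <= C_n t / n^2], hence
    [E exp (l (X t - X_n t)) <= exp (phi (l tau t))] with
    [tau t = CX (C_n t)^(1/2) / n].

    For [x = (eps / S)^(1/p)] and [v x >= p], Bernoulli's inequality gives
    [exp (v y) >= exp (v x) (1 + (v x / p) ((y / x)^p - 1))]. Taking
    [y = |X t - X_n t| / tau t] and averaging over [0, T] with density
    [(tau t)^p / S], the event [\int |X - X_n|^p > eps] forces the average of
    [exp (v y)] to exceed [exp (v x)], so by Markov its probability is at most
    [2 exp (phi v - v x)]. The condition [f (p / x) < x] says that the
    supremum defining [phi^* x] is approached on [v >= p / x]. *)

Set Implicit Arguments.
Unset Strict Implicit.
Unset Printing Implicit Defensive.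
Local Open Scope classical_set_scope.
Local Open Scope ring_scope.

(** * Oscillating integrals by the mean value theorem *)

(** Quantitative Riemann-Lebesgue lemma: [G b - G a] plays the integral of [r x * sin (m * x)].
    Derivatives are asked only inside the interval, so that [r] may be a quotient extended by
    continuity to an endpoint. *)
Lemma riemann_lebesgue_sin (R : realType) (G r dr : R -> R) (m K0 K a b : R) :
  0 < m -> a <= b ->
  (forall x, x \in `]a, b[ -> is_derive x 1 G (r x * sin (m * x))) ->
  (forall x, x \in `]a, b[ -> is_derive x 1 r (dr x)) ->
  {within `[a, b], continuous G} -> {within `[a, b], continuous r} ->
  `|r a| <= K0 -> `|r b| <= K0 ->
  (forall x, x \in `]a, b[ -> `|dr x| <= K) ->
  `|G b - G a| <= (K0 *+ 2 + K * (b - a)) / m.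
Proof.
move=> m0; rewrite le_eqVlt => /predU1P[<- _ _ _ _ ra _ _|ab dG dr_ cG cr ra rb drK].
  by rewrite !subrr normr0 mulr0 addr0 divr_ge0 ?mulrn_wge0// ?(le_trans _ ra)// ltW.
have m0' : m != 0 by rewrite gt_eqF.
(* Integration by parts turns [r x * sin (m x)] into [dr x * cos (m x) / m]; the
   mean value theorem for [H] then avoids the integral. *)
pose H x := G x + r x * (cos (m * x) / m).
have dH x : x \in `]a, b[ -> is_derive x 1 H (dr x * (cos (m * x) / m)).
  move=> xab; have h1 := dG _ xab; have h2 := dr_ _ xab.
  apply: is_derive_eq; rewrite /GRing.scale/= !mulr0 ?addr0 !mulr1.
  by rewrite {h1 h2}; field.
have cH : {within `[a, b], continuous H}.
  move=> x; apply: cvgD; first exact: cG.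
  apply: cvgM; first exact: cr.
  suff: {within `[a, b], continuous (fun y => cos (m * y) / m)} by apply.
  apply: continuous_subspaceT => {}x.
  apply: cvgM; last exact: cvg_cst.
  apply: (@continuous_comp _ _ _ (fun x => m * x) cos); last exact: continuous_cos.
  exact: mulrl_continuous.
have [c cab] := MVT ab dH cH.
have -> : G b - G a = H b - H a - r b * (cos (m * b) / m) + r a * (cos (m * a) / m).
  by rewrite /H; ring.
move=> ->.
have cosm x : `|cos (m * x) / m| <= m^-1.
  rewrite normrM [`|m^-1|]gtr0_norm ?invr_gt0// ler_piMl ?invr_ge0 ?(ltW m0)//.
  by rewrite ler_norml cos_geN1 cos_le1.
have -> : (K0 *+ 2 + K * (b - a)) / m = K * m^-1 * (b - a) + K0 * m^-1 + K0 * m^-1 by ring.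
apply: (le_trans (ler_normD _ _)); apply: lerD.
  apply: (le_trans (ler_normB _ _)); apply: lerD.
    rewrite normrM [`|b - a|]gtr0_norm ?subr_gt0// ler_wpM2r ?subr_ge0 ?(ltW ab)//.
    by rewrite normrM ler_pM// drK.
  by rewrite normrM ler_pM.
by rewrite normrM ler_pM.
Qed.

(* The index [j] stands for [k = j - N], as in [trunc_sampling]. *)
Definition sum_sym (R : realType) (N : nat) (h : R -> R) : R :=
  \sum_(j < (2 * N).+1) h (j%:R - N%:R).

Lemma sum_sym0 (R : realType) (h : R -> R) : sum_sym 0 h = h 0.
Proof. by rewrite /sum_sym big_ord1 subrr. Qed.

Lemma sum_symS (R : realType) (N : nat) (h : R -> R) :
  sum_sym N.+1 h = sum_sym N h + (h N.+1%:R + h (- N.+1%:R)).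
Proof.
rewrite /sum_sym mulnS addSn big_ord_recl big_ord_recr/=.
rewrite /bump/= !add1n sub0r [LHS]addrC -addrA; congr (_ + (_ + _)).
- apply: eq_bigr => i _; congr (h _); rewrite !mulrSr; ring.
- by congr (h _); rewrite -!natr1 natrM; ring.
Qed.

Lemma eq_sum_sym (R : realType) (N : nat) (h1 h2 : R -> R) :
  h1 =1 h2 -> sum_sym N h1 = sum_sym N h2.
Proof. by move=> h12; apply: eq_bigr => i _. Qed.

Lemma sum_symD (R : realType) (N : nat) (h1 h2 : R -> R) :
  sum_sym N (fun k => h1 k + h2 k) = sum_sym N h1 + sum_sym N h2.
Proof. exact: big_split. Qed.

Lemma sum_symZ (R : realType) (N : nat) (c : R) (h : R -> R) :
  sum_sym N (fun k => c * h k) = c * sum_sym N h.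
Proof. by rewrite /sum_sym mulr_sumr. Qed.

Lemma sum_symB (R : realType) (N : nat) (h1 h2 : R -> R) :
  sum_sym N (fun k => h1 k - h2 k) = sum_sym N h1 - sum_sym N h2.
Proof. exact: sumrB. Qed.

(** * The Dirichlet kernel *)

Lemma sum_sym_sin (R : realType) (N : nat) (b : R) :
  sum_sym N (fun k => sin (k * b)) = 0.
Proof.
elim: N => [|N IH]; first by rewrite sum_sym0 mul0r sin0.
by rewrite sum_symS IH mulNr sinN subrr addr0.
Qed.

(** The product form is meaningful where [sin (b / 2)] vanishes too. Each induction step adds the
    difference of the sines of [(N + 1) b + b / 2] and [(N + 1) b - b / 2]. *)
Lemma dirichlet_kernel (R : realType) (N : nat) (b : R) :
  sum_sym N (fun k => cos (k * b)) * sin (b / 2) = sin ((N%:R + 2^-1) * b).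
Proof.
elim: N => [|N IH]; first by rewrite sum_sym0 mul0r cos0 mul1r; congr sin; field.
rewrite sum_symS mulrDl IH mulNr cosN.
have -> : (N%:R + 2^-1) * b = N.+1%:R * b - b / 2 by rewrite -natr1; field.
have -> : (N.+1%:R + 2^-1) * b = N.+1%:R * b + b / 2 by field.
rewrite sinB sinD; ring.
Qed.

Lemma is_derive_sum_sym (R : realType) (N : nat) (h dh : R -> R -> R) (x : R) :
  (forall k, is_derive x 1 (h k) (dh k x)) ->
  is_derive x 1 (fun y => sum_sym N (fun k => h k y)) (sum_sym N (fun k => dh k x)).
Proof.
move=> hd; elim: N => [|N IH].
  under [X in is_derive _ _ X _]eq_fun do rewrite sum_sym0.
  by rewrite sum_sym0.
under [X in is_derive _ _ X _]eq_fun do rewrite sum_symS.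
rewrite sum_symS.
have h1 := hd N.+1%:R; have h2 := hd (- N.+1%:R).
exact: is_deriveD.
Qed.

(* [fun b => \int_0^b cos (t x) dt] and [fun b => \int_0^b sin (t x) dt]; at [x = 0]
   the division by 0 gives 0, the right value for [cos_prim]. *)
Definition sin_prim (R : realType) (x b : R) : R := if x == 0 then b else sin (b * x) / x.
Definition cos_prim (R : realType) (x b : R) : R := (1 - cos (b * x)) / x.

Lemma is_derive_sin_prim (R : realType) (x b : R) :
  is_derive b 1 (sin_prim x) (cos (b * x)).
Proof.
rewrite /sin_prim; case: eqVneq => [->|x0].
  by rewrite mulr0 cos0; apply: is_derive_id.
by apply: is_derive_eq; rewrite /GRing.scale/= !mulr0 ?addr0 ?add0r !mulr1; field.
Qed.

Lemma is_derive_cos_prim (R : realType) (x b : R) :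
  is_derive b 1 (cos_prim x) (sin (b * x)).
Proof.
rewrite /cos_prim; apply: is_derive_eq.
rewrite /GRing.scale/= !mulr0 ?addr0 ?add0r !mulr1.
have [->|x0] := eqVneq x 0; first by rewrite !mulr0 sin0; ring.
by field.
Qed.

Lemma sin_prim_sinc (R : realType) (x b : R) : sin_prim x b = b * sinc (b * x).
Proof.
rewrite /sin_prim /sinc mulf_eq0; case: (eqVneq b 0) => [->|b0] /=.
  by rewrite !mul0r sin0 mul0r; case: ifP.
by case: eqVneq => x0 /=; [rewrite mulr1 | field; rewrite x0 b0].
Qed.

Lemma is_derive_continuous (R : realType) (f df : R -> R) (i : interval R) :
  (forall x : R, x \in i -> is_derive x 1 f (df x)) -> {within [set` i], continuous f}.
Proof.
move=> fd; apply: derivable_within_continuous => x xi.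
by have h := fd _ xi; exact: ex_derive.
Qed.

(** * Elementary bounds for sine and cosine *)

Lemma sin_norm_le (R : realType) (x : R) : `|sin x| <= `|x|.
Proof.
wlog x0 : x / 0 <= x.
  move=> H; have [/H//|/ltW x0] := leP 0 x.
  by rewrite -normrN -sinN -[leRHS]normrN H// oppr_ge0.
have [c _] := @MVT_segment R sin cos 0 x x0 (fun x _ => is_derive_sin x)
  (is_derive_continuous (fun x _ => is_derive_sin x)).
rewrite sin0 !subr0 => ->; rewrite normrM ler_piMl// ler_norml.
by rewrite cos_geN1 cos_le1.
Qed.

Lemma cos_half (R : realType) (x : R) : cos x = 1 - 2 * sin (x / 2) ^+ 2.
Proof.
have {1}-> : x = (x / 2) *+ 2 by rewrite -mulr_natr; field.
by rewrite cos_mulr2n; have := cos2Dsin2 (x / 2); lra.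
Qed.

Lemma one_sub_cos_bound (R : realType) (x : R) : 0 <= 1 - cos x <= x ^+ 2 / 2.
Proof.
rewrite cos_half subKr; apply/andP; split; first by rewrite mulr_ge0// sqr_ge0.
have : sin (x / 2) ^+ 2 <= (x / 2) ^+ 2.
  by rewrite -(real_normK (num_real (sin _))) -(real_normK (num_real (x / 2)))
    lerXn2r ?nnegrE// sin_norm_le.
nra.
Qed.

(** From [sin y = 2 sin (y / 2) cos (y / 2)]: the mean value theorem gives
    [sin (y / 2) >= (y / 2) cos (y / 2)], and the square of [cos (y / 2)] is at least 1/2 because
    [cos y >= 0]. *)
Lemma sin_ge_half (R : realType) (y : R) : 0 <= y <= pi / 2 -> y / 2 <= sin y.
Proof.
move=> /andP[y0 ypi].
have h0 : 0 <= y / 2 by rewrite divr_ge0.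
have [c] := @MVT_segment R sin cos 0 (y / 2) h0 (fun x _ => is_derive_sin x)
  (is_derive_continuous (fun x _ => is_derive_sin x)).
rewrite sin0 !subr0 in_itv/= => /andP[c0 cy] sE.
have pi0 := pi_gt0 R.
have cpi : c <= pi by lra.
have chalf : cos (y / 2) <= cos c.
  move: cy; rewrite le_eqVlt => /predU1P[->//|cy].
  by apply/ltW; rewrite ltr_cos// in_itv/= ?c0 ?cpi ?h0//=; lra.
have cy0 : 0 <= cos (y / 2) by apply: cos_ge0_pihalf; lra.
have cosy : 0 <= cos y by apply: cos_ge0_pihalf; lra.
have -> : sin y = 2 * sin (y / 2) * cos (y / 2).
  have {1}-> : y = (y / 2) *+ 2 by rewrite -mulr_natr; field.
  by rewrite sin_mulr2n -mulr_natr; ring.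
have c2 : 2^-1 <= cos (y / 2) ^+ 2.
  have h1 := cos2Dsin2 (y / 2); have h2 := cos_half y.
  by rewrite h2 in cosy; lra.
rewrite sE; apply: (@le_trans _ _ (y * cos (y / 2) ^+ 2)).
  by rewrite ler_wpM2l.
have -> : 2 * (cos c * (y / 2)) * cos (y / 2) = y * (cos c * cos (y / 2)) by field.
by rewrite ler_wpM2l// expr2 ler_wpM2r.
Qed.

(** * Oscillation of modulated Dirichlet kernels *)

Lemma sum_sym_cosB (R : realType) (N : nat) (u b : R) :
  sum_sym N (fun k => cos (b * (u - k))) = cos (u * b) * sum_sym N (fun k => cos (k * b)).
Proof.
rewrite (eq_sum_sym _ (h2 := fun k =>
    cos (u * b) * cos (k * b) + sin (u * b) * sin (k * b))); last first.
  by move=> k; rewrite mulrBr cosB ![b * _]mulrC.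
by rewrite sum_symD !sum_symZ sum_sym_sin mulr0 addr0.
Qed.

Lemma sum_sym_sinB (R : realType) (N : nat) (u b : R) :
  sum_sym N (fun k => sin (b * (u - k))) = sin (u * b) * sum_sym N (fun k => cos (k * b)).
Proof.
rewrite (eq_sum_sym _ (h2 := fun k =>
    sin (u * b) * cos (k * b) - cos (u * b) * sin (k * b))); last first.
  by move=> k; rewrite mulrBr sinB ![b * _]mulrC.
by rewrite sum_symB !sum_symZ sum_sym_sin mulr0 subr0.
Qed.

Lemma sum_sym_cosE (R : realType) (N : nat) (b : R) : sin (b / 2) != 0 ->
  sum_sym N (fun k => cos (k * b)) = sin ((N%:R + 2^-1) * b) / sin (b / 2).
Proof. by move=> s0; rewrite -dirichlet_kernel mulfK. Qed.

(** This is [riemann_lebesgue_sin] for [r = h / sin (x / 2)], whose derivative is at most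
    [(U + 1) / s0^2] because the denominator stays above [s0]. The factors [h] will be [cos (u x)]
    and [sin (u x)], with [U = |u|]. *)
Lemma riemann_lebesgue_away (R : realType) (G h dh : R -> R) (m U s0 a b : R) :
  0 < m -> a <= b -> 0 < s0 ->
  (forall x : R, x \in `[a, b] -> s0 <= sin (x / 2)) ->
  (forall x : R, is_derive x 1 h (dh x)) -> (forall x, `|h x| <= 1) ->
  (forall x, `|dh x| <= U) ->
  (forall x : R, x \in `[a, b] -> is_derive x 1 G (h x * (sin (m * x) / sin (x / 2)))) ->
  `|G b - G a| <= (s0^-1 *+ 2 + (U + 1) / s0 ^+ 2 * (b - a)) / m.
Proof.
move=> m0 ab s00 s0P hd h1 dhU dG.
have sn0 x : x \in `[a, b] -> sin (x / 2) != 0.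
  by move=> /s0P h0; rewrite gt_eqF// (lt_le_trans s00 h0).
have sub x : x \in `]a, b[ -> x \in `[a, b] by rewrite !in_itv/= => /andP[/ltW-> /ltW->].
pose r x := h x / sin (x / 2).
pose dr x := (dh x * sin (x / 2) - h x * (cos (x / 2) / 2)) / sin (x / 2) ^+ 2.
have rd x : x \in `[a, b] -> is_derive x 1 r (dr x).
  move=> xab; have s0x := sn0 _ xab; have hdx := hd x.
  have dinv := @is_deriveV R (fun x => sin (x / 2)) x _ _ s0x _.
  have /dinv dinv' : is_derive x 1 (fun x => sin (x / 2)) (cos (x / 2) / 2).
    by apply: is_derive_eq; rewrite /GRing.scale/=; field.
  by apply: is_derive_eq; rewrite /GRing.scale/= /dr; field.
have r_le x : x \in `[a, b] -> `|r x| <= s0^-1.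
  move=> xab; have sx := s0P _ xab.
  rewrite /r normrM -[leRHS]mul1r ler_pM// normfV lef_pV2 ?posrE ?normr_gt0 ?sn0//.
  by rewrite (le_trans sx)// ler_norm.
have aab : a \in `[a, b] by rewrite in_itv/= lexx.
have bab : b \in `[a, b] by rewrite in_itv/= lexx andbT.
have dG' x : x \in `]a, b[ -> is_derive x 1 G (r x * sin (m * x)).
  move=> /sub xab; have dGx := dG _ xab.
  have -> : r x * sin (m * x) = h x * (sin (m * x) / sin (x / 2)) by rewrite /r; ring.
  exact: dGx.
apply: (riemann_lebesgue_sin m0 ab dG' (fun x xab => rd x (sub x xab))
  (is_derive_continuous dG) (is_derive_continuous rd) (r_le _ aab) (r_le _ bab)).
move=> x /sub xab; have sx := s0P _ xab; have sx0 : 0 < sin (x / 2) by exact: lt_le_trans sx.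
rewrite /dr normrM ler_pM//; last first.
  rewrite normfV normrX lef_pV2 ?posrE ?exprn_gt0 ?normr_gt0 ?sn0// gtr0_norm//.
  by rewrite lerXn2r ?nnegrE ?(ltW sx0) ?(ltW s00).
apply: (le_trans (ler_normB _ _)); rewrite lerD//.
  by rewrite normrM -[leRHS]mulr1 ler_pM// sin_max.
rewrite normrM -[leRHS]mulr1 ler_pM// normrM -[leRHS]mulr1 ler_pM//.
  by rewrite ler_norml cos_geN1 cos_le1.
by rewrite ger0_norm// invf_le1// ler1n.
Qed.

(** * Pointwise convergence of the sampling series *)

Lemma sin_nat_pi (R : realType) (k : nat) : sin (pi * k%:R) = 0 :> R.
Proof.
elim: k => [|k IH]; first by rewrite mulr0 sin0.
by rewrite -natr1 mulrDr mulr1 sinD IH sinpi mul0r mulr0 addr0.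
Qed.

(** Only [k = 0] contributes, since [sin (k pi) = 0]. This is the integral of the Dirichlet kernel
    over [[0, pi]]. *)
Lemma sum_sym_sin_prim_pi (R : realType) (N : nat) :
  sum_sym N (fun k => sin_prim k pi) = pi :> R.
Proof.
elim: N => [|N IH]; first by rewrite sum_sym0 /sin_prim eqxx.
rewrite sum_symS IH /sin_prim oppr_eq0 pnatr_eq0/= mulrN sinN sin_nat_pi.
by rewrite oppr0 !mul0r !addr0.
Qed.

(** Both rest on [sin (x / 2) >= x / 4] and [1 - cos (u x) <= (u x)^2 / 2]. The second quotient is
    the derivative of the first, so the zero of [sin (x / 2)] at 0 does no harm in the oscillating
    integral. *)
Lemma cos_quotient_bounds (R : realType) (u x : R) : 0 < x <= pi ->
  (1 - cos (u * x)) / sin (x / 2) <= 2 * u ^+ 2 * x /\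
  `|(u * sin (u * x) * sin (x / 2) - (1 - cos (u * x)) * (cos (x / 2) / 2)) /
    sin (x / 2) ^+ 2| <= 8 * u ^+ 2.
Proof.
move=> /andP[x0 xpi].
have s_ge : x / 4 <= sin (x / 2).
  have -> : x / 4 = x / 2 / 2 by field.
  by apply: sin_ge_half; lra.
set s := sin (x / 2) in s_ge *.
have s0 : 0 < s by apply: lt_le_trans s_ge; rewrite divr_gt0.
have /andP[c0 c1] := one_sub_cos_bound (u * x).
set w := 1 - cos (u * x) in c0 c1 *.
split.
  rewrite ler_pdivrMr// (le_trans c1)//.
  have h : 0 <= 2 * u ^+ 2 * x by rewrite (mulr_ge0 _ (ltW x0))// mulr_ge0// sqr_ge0.
  have -> : (u * x) ^+ 2 / 2 = 2 * u ^+ 2 * x * (x / 4) by field.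
  exact: ler_wpM2l h _ _ s_ge.
have h1 : `|u * sin (u * x) * s| <= u ^+ 2 * x * s.
  rewrite normrM [`|s|]gtr0_norm// ler_wpM2r ?(ltW s0)// normrM.
  have -> : u ^+ 2 * x = `|u| * `|u * x|.
    by rewrite normrM [`|x|]gtr0_norm// mulrA -expr2 real_normK ?num_real.
  by rewrite ler_wpM2l// sin_norm_le.
have h2 : `|w * (cos (x / 2) / 2)| <= u ^+ 2 * x ^+ 2 / 4.
  have -> : u ^+ 2 * x ^+ 2 / 4 = (u * x) ^+ 2 / 2 * 2^-1 by field.
  rewrite normrM ler_pM//; first by rewrite ger0_norm.
  rewrite normrM [`|2^-1|]ger0_norm// ler_piMl// ler_norml.
  by rewrite cos_geN1 cos_le1.
rewrite normrM normfV [`|s ^+ 2|]ger0_norm ?sqr_ge0//.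
rewrite ler_pdivrMr ?exprn_gt0// (le_trans (ler_normB _ _))// (le_trans (lerD h1 h2))//.
have u2 : 0 <= u ^+ 2 by rewrite sqr_ge0.
have -> : 8 * u ^+ 2 * s ^+ 2 = u ^+ 2 * (8 * s ^+ 2) by ring.
have -> : u ^+ 2 * x * s + u ^+ 2 * x ^+ 2 / 4 = u ^+ 2 * (x * s + x ^+ 2 / 4) by field.
rewrite ler_wpM2l//.
have hx : x <= 4 * s by lra.
have := ler_wpM2r (ltW s0) hx; have := ler_pM (ltW x0) (ltW x0) hx hx; rewrite !expr2; lra.
Qed.

(** With [pi] written as the sum for [u = 0], the difference is the integral over [[0, pi]] of
    [1 - cos (u x)] times the Dirichlet kernel, that is, of [r x * sin ((N + 1/2) x)]; [V] is its
    primitive. The constants 2 and [8 u^2] bound [r] at the endpoints and its derivative. *)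
Lemma sum_sym_sin_prim_dist_pi (R : realType) (u : R) (N : nat) :
  `|pi - sum_sym N (fun k => sin_prim (u - k) pi)| <=
  (2 *+ 2 + 8 * u ^+ 2 * pi) / (N%:R + 2^-1).
Proof.
pose V x := sum_sym N (fun k => sin_prim k x) - sum_sym N (fun k => sin_prim (u - k) x).
pose r x := (1 - cos (u * x)) / sin (x / 2).
pose dr x := (u * sin (u * x) * sin (x / 2) - (1 - cos (u * x)) * (cos (x / 2) / 2)) /
    sin (x / 2) ^+ 2.
have pi0 := pi_gt0 R.
have V0 : V 0 = 0.
  rewrite /V -sum_symB (eq_sum_sym _ (h2 := fun k => 0 * k)) ?sum_symZ ?mul0r//.
  by move=> k; rewrite /sin_prim !mul0r sin0 !mul0r !if_same subrr.
rewrite -[X in `|X - _|](sum_sym_sin_prim_pi R N) -/(V pi) -[V pi]subr0 -V0.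
rewrite -[X in 8 * _ * X]subr0.
have s_gt0 (x : R) : 0 < x <= pi -> 0 < sin (x / 2).
  by move=> /andP[x0 xpi]; apply: sin_gt0_pi; lra.
have dV (x : R) : is_derive x 1 V ((1 - cos (u * x)) * sum_sym N (fun k => cos (k * x))).
  have d1 := @is_derive_sum_sym R N _ (fun k y => cos (y * k)) x
    (fun k => is_derive_sin_prim k x).
  have d2 := @is_derive_sum_sym R N _ (fun k y => cos (y * (u - k))) x
    (fun k => is_derive_sin_prim (u - k) x).
  apply: (is_derive_eq (is_deriveB d1 d2)).
  rewrite sum_sym_cosB (eq_sum_sym _ (h2 := fun k => cos (k * x))); last first.
    by move=> k; rewrite mulrC.
  ring.
have dV' (x : R) : x \in `]0, pi[ -> is_derive x 1 V (r x * sin ((N%:R + 2^-1) * x)).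
  rewrite in_itv/= => /andP[x0 xpi]; have dVx := dV x.
  have sx : sin (x / 2) != 0 by rewrite gt_eqF// s_gt0// x0 ltW.
  rewrite sum_sym_cosE// in dVx.
  by apply: (is_derive_eq dVx); rewrite /r; field.
have rd (x : R) : x \in `]0, pi] -> is_derive x 1 r (dr x).
  rewrite in_itv/= => x0pi.
  have sx : sin (x / 2) != 0 by rewrite gt_eqF// s_gt0.
  have dinv := @is_deriveV R (fun x => sin (x / 2)) x _ _ sx _.
  have /dinv dinv' : is_derive x 1 (fun x => sin (x / 2)) (cos (x / 2) / 2).
    by apply: is_derive_eq; rewrite /GRing.scale/=; field.
  by apply: is_derive_eq; rewrite /GRing.scale/= /dr; field.
have sub (x : R) : x \in `]0, pi[ -> x \in `]0, pi].
  by rewrite !in_itv/= => /andP[-> /ltW->].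
have r0 : r 0 = 0 by rewrite /r mulr0 cos0 subrr mul0r.
have r_ge0 (x : R) : 0 < x <= pi -> 0 <= r x.
  move=> x0; apply: divr_ge0; last exact/ltW/s_gt0.
  by have /andP[] := one_sub_cos_bound (u * x).
have cr : {within `[0, pi], continuous r}.
  apply/continuous_within_itvP => //; split.
  - move=> x /sub /rd h.
    by apply: differentiable_continuous; apply/derivable1_diffP; exact: ex_derive.
  (* The value [r 0 = 0] comes from division by 0, but it is the right limit, as
     [0 <= r x <= 2 u^2 x] near 0. *)
  - rewrite r0; apply: (@squeeze_cvgr _ _ _ _ (fun=> 0) (fun x => 2 * u ^+ 2 * x)).
    + near=> x.
      have hx : 0 < x <= pi by apply/andP; split; near: x;
        [exact: nbhs_right_gt|exact: nbhs_right_le].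
      by rewrite r_ge0//=; exact: (cos_quotient_bounds u hx).1.
    + exact: cvg_cst.
    + rewrite -[X in _ --> X](mulr0 (2 * u ^+ 2)).
      apply: cvg_at_right_filter.
      exact: mulrl_continuous.
  - have h := rd pi; rewrite in_itv/= pi0 lexx in h.
    apply: cvg_at_left_filter.
    apply: differentiable_continuous; apply/derivable1_diffP.
    by have h' := h isT; exact: ex_derive.
apply: (@riemann_lebesgue_sin R V r dr (N%:R + 2^-1) 2 (8 * u ^+ 2) 0 pi
  _ (ltW pi0) dV' (fun x h => rd x (sub x h)) _ cr).
- by rewrite ltr_wpDl.
- exact: (@is_derive_continuous _ _ _ `[0, pi] (fun x _ => dV x)).
- by rewrite r0 normr0.
- have hpi : 0 < (pi : R) <= pi by rewrite pi0 lexx.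
  rewrite ger0_norm ?r_ge0// /r sin_pihalf divr1.
  have := cos_geN1 (u * pi); lra.
- move=> x; rewrite in_itv/= => /andP[x0 xpi].
  by apply: (cos_quotient_bounds u _).2; rewrite x0 ltW.
Unshelve. all: by end_near. Qed.

(** The interval avoids the zeros 0 and [2 pi] of [sin (x / 2)]. Beyond [pi], replacing [x / 2] by
    [pi - x / 2] brings the argument back to the range of [sin_ge_half]. *)
Lemma sin_half_away (R : realType) (th x : R) : th < pi ->
  pi - th <= x <= pi + th -> (pi - th) / 4 <= sin (x / 2).
Proof.
move=> thpi /andP[x1 x2].
have [xpi|/ltW xpi] := leP x pi.
  apply: (@le_trans _ _ (x / 2 / 2)); first by lra.
  by apply: sin_ge_half; lra.
have -> : sin (x / 2) = sin (pi - x / 2).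
  by rewrite sinB sinpi cospi; ring.
apply: (@le_trans _ _ ((pi - x / 2) / 2)); first by lra.
by apply: sin_ge_half; lra.
Qed.

Lemma is_derive_sum_sym_sin_prim (R : realType) (u x : R) (N : nat) :
  sin (x / 2) != 0 ->
  is_derive x 1 (fun y => sum_sym N (fun k => sin_prim (u - k) y))
    (cos (u * x) * (sin ((N%:R + 2^-1) * x) / sin (x / 2))).
Proof.
move=> sx; rewrite -sum_sym_cosE// -sum_sym_cosB.
exact: (@is_derive_sum_sym R N _ (fun k y => cos (y * (u - k))) x
  (fun k => is_derive_sin_prim (u - k) x)).
Qed.

Lemma is_derive_sum_sym_cos_prim (R : realType) (u x : R) (N : nat) :
  sin (x / 2) != 0 ->
  is_derive x 1 (fun y => sum_sym N (fun k => cos_prim (u - k) y))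
    (sin (u * x) * (sin ((N%:R + 2^-1) * x) / sin (x / 2))).
Proof.
move=> sx; rewrite -sum_sym_cosE// -sum_sym_sinB.
exact: (@is_derive_sum_sym R N _ (fun k y => sin (y * (u - k))) x
  (fun k => is_derive_cos_prim (u - k) x)).
Qed.

(** The increments are integrals over [[a, b]] of [cos (u x)] and [sin (u x)] times the kernel,
    where [sin (x / 2) >= (pi - th) / 4]. *)
Lemma sum_sym_prim_oscillation (R : realType) (u th a b : R) (N : nat) : th < pi ->
  pi - th <= a -> a <= b -> b <= pi + th ->
  let c := ((pi - th) / 4)^-1 *+ 2 + (`|u| + 1) / ((pi - th) / 4) ^+ 2 * (b - a) in
  `|sum_sym N (fun k => sin_prim (u - k) b) - sum_sym N (fun k => sin_prim (u - k) a)|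
    <= c / (N%:R + 2^-1) /\
  `|sum_sym N (fun k => cos_prim (u - k) b) - sum_sym N (fun k => cos_prim (u - k) a)|
    <= c / (N%:R + 2^-1).
Proof.
move=> thpi tha ab bth c.
have s0 : 0 < (pi - th) / 4 by rewrite divr_gt0// subr_gt0.
have s_ge (x : R) : x \in `[a, b] -> (pi - th) / 4 <= sin (x / 2).
  rewrite in_itv/= => /andP[ax xb]; apply: sin_half_away => //.
  by rewrite (le_trans tha ax) (le_trans xb bth).
have sn0 (x : R) : x \in `[a, b] -> sin (x / 2) != 0.
  by move=> /s_ge h; rewrite gt_eqF// (lt_le_trans s0 h).
have m0 : 0 < N%:R + 2^-1 :> R by rewrite ltr_wpDl.
have dcos (x : R) : is_derive x 1 (fun y => cos (u * y)) (- (u * sin (u * x))).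
  by apply: is_derive_eq; rewrite /GRing.scale/=; ring.
have dsin (x : R) : is_derive x 1 (fun y => sin (u * y)) (u * cos (u * x)).
  by apply: is_derive_eq; rewrite /GRing.scale/=; ring.
have cos_le (x : R) : `|cos x| <= 1 by rewrite ler_norml cos_geN1 cos_le1.
have dcos_le (x : R) : `|- (u * sin (u * x))| <= `|u|.
  by rewrite normrN normrM -[leRHS]mulr1 ler_pM// sin_max.
have dsin_le (x : R) : `|u * cos (u * x)| <= `|u|.
  by rewrite normrM -[leRHS]mulr1 ler_pM.
split.
  exact: (riemann_lebesgue_away m0 ab s0 s_ge dcos (fun x => cos_le (u * x)) dcos_le
    (fun x xab => is_derive_sum_sym_sin_prim u N (sn0 x xab))).
exact: (riemann_lebesgue_away m0 ab s0 s_ge dsin (fun x => sin_max (u * x)) dsin_le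
  (fun x xab => is_derive_sum_sym_cos_prim u N (sn0 x xab))).
Qed.

(** Since [sinc (pi x)] is [sin_prim x pi / pi], the product-to-sum formula turns the summand into
    primitives evaluated at [pi + th] and [pi - th]. *)
Lemma sinc_mul_cos (R : realType) (x th : R) :
  sinc (pi * x) * cos (th * x) = (sin_prim x (pi + th) + sin_prim x (pi - th)) / (2 * pi).
Proof.
have pi0 : pi != 0 :> R by rewrite gt_eqF// pi_gt0.
have -> : sinc (pi * x) = sin_prim x pi / pi by rewrite sin_prim_sinc mulrAC divff// mul1r.
rewrite /sin_prim; case: eqVneq => [->|x0].
  have -> : pi + th + (pi - th) = 2 * pi by ring.
  by rewrite mulr0 cos0 !divff ?mulr1 ?mulf_neq0 ?pnatr_eq0.
rewrite (mulrDl pi th) (mulrBl x pi) sinD sinB.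
by move: (pi : R) pi0 => q q0; field; rewrite x0 q0.
Qed.

Lemma sinc_mul_sin (R : realType) (x th : R) :
  sinc (pi * x) * sin (th * x) = (cos_prim x (pi + th) - cos_prim x (pi - th)) / (2 * pi).
Proof.
have pi0 : pi != 0 :> R by rewrite gt_eqF// pi_gt0.
have -> : sinc (pi * x) = sin_prim x pi / pi by rewrite sin_prim_sinc mulrAC divff// mul1r.
rewrite /sin_prim /cos_prim; case: eqVneq => [->|x0].
  by rewrite !mulr0 sin0 invr0 !mulr0 subrr mul0r.
rewrite (mulrDl pi th) (mulrBl x pi) cosD cosB.
by move: (pi : R) pi0 => q q0; field; rewrite x0 q0.
Qed.

(* [1 - e^(-i u th) sum_k sinc (pi (u - k)) e^(i k th)] in real and imaginary
   parts; by [sinc_mul_cos] and [sinc_mul_sin] they are increments of sums of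
   [sin_prim] and [cos_prim] over [pi - th, pi + th]. *)
Lemma sampling_series_cvg (R : realType) (u th : R) : 0 <= th -> th < pi ->
  exists K, forall N : nat,
    `|1 - sum_sym N (fun k => sinc (pi * (u - k)) * cos (th * (u - k)))| <= K / (N%:R + 2^-1) /\
    `|sum_sym N (fun k => sinc (pi * (u - k)) * sin (th * (u - k)))| <= K / (N%:R + 2^-1).
Proof.
move=> th0 thpi.
have pi0 := pi_gt0 R.
pose c (l : R) := ((pi - th) / 4)^-1 *+ 2 + (`|u| + 1) / ((pi - th) / 4) ^+ 2 * l.
pose d : R := 2 *+ 2 + 8 * u ^+ 2 * pi.
exists ((d + c th + c (th *+ 2)) / pi) => N.
have m0 : 0 < N%:R + 2^-1 :> R by rewrite ltr_wpDl.
have c0 (l : R) : 0 <= l -> 0 <= c l.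
  have s0 : 0 <= (pi - th) / 4 by rewrite divr_ge0// subr_ge0 ltW.
  move=> l0; rewrite addr_ge0// ?mulrn_wge0 ?invr_ge0//.
  by rewrite mulr_ge0// divr_ge0 ?addr_ge0// sqr_ge0.
have d0 : 0 <= d by rewrite addr_ge0// mulr_ge0 ?(ltW pi0)// mulr_ge0// sqr_ge0.
have cth := c0 _ th0; have cth2 : 0 <= c (th *+ 2) by rewrite c0// mulrn_wge0.
have h0 := sum_sym_sin_prim_dist_pi u N.
have [h1 _] := @sum_sym_prim_oscillation R u th pi (pi + th) N thpi
  ltac:(lra) ltac:(lra) ltac:(lra).
have [h2 _] := @sum_sym_prim_oscillation R u th (pi - th) pi N thpi
  ltac:(lra) ltac:(lra) ltac:(lra).
have [_ h3] := @sum_sym_prim_oscillation R u th (pi - th) (pi + th) N thpi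
  ltac:(lra) ltac:(lra) ltac:(lra).
have e1 : pi + th - pi = th by ring.
have e2 : pi - (pi - th) = th by ring.
have e3 : pi + th - (pi - th) = th *+ 2 by ring.
rewrite e1 -/(c th) in h1; rewrite e2 -/(c th) in h2; rewrite e3 -/(c (th *+ 2)) in h3.
rewrite -/d in h0.
under [X in `|1 - X|]eq_sum_sym do rewrite sinc_mul_cos mulrC.
under [X in _ /\ `|X| <= _]eq_sum_sym do rewrite sinc_mul_sin mulrC.
rewrite !sum_symZ sum_symD sum_symB.
move: h0 h1 h2 h3.
set s := sum_sym _ _; set s1 := sum_sym _ _; set s2 := sum_sym _ _.
set t1 := sum_sym _ _; set t2 := sum_sym _ _ => h0 h1 h2 h3.
have pin0 : pi != 0 :> R by rewrite gt_eqF.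
(* Here [s], [s1], [s2] are the sums at [pi], [pi + th], [pi - th]. Passing through [s] leaves one
   distance to [pi] and two increments, all of order [1 / N]. *)
have -> : 1 - (2 * pi)^-1 * (s1 + s2) =
    pi^-1 * ((pi - s) - 2^-1 * (s1 - s) + 2^-1 * (s - s2)).
  by move: (pi : R) pin0 => q q0; field.
have -> : (2 * pi)^-1 * (t1 - t2) = pi^-1 * (2^-1 * (t1 - t2)).
  by move: (pi : R) pin0 => q q0; field.
have -> : (d + c th + c (th *+ 2)) / pi / (N%:R + 2^-1) =
    pi^-1 * (d / (N%:R + 2^-1) + c th / (N%:R + 2^-1) + c (th *+ 2) / (N%:R + 2^-1)).
  by move: (N%:R + 2^-1 : R) (gt_eqF m0) (pi : R) pin0 => m /negbT m1 q q0; field; rewrite m1.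
have pd (l : R) : 0 <= l -> 0 <= l / (N%:R + 2^-1) by move=> l0; rewrite divr_ge0// ltW.
have := pd _ d0; have := pd _ cth; have := pd _ cth2 => p1 p2 p3.
by split; rewrite normrM gtr0_norm ?invr_gt0// ler_pM2l ?invr_gt0//;
   move: h0 h1 h2 h3; rewrite !ler_norml; lra.
Qed.

(** * The truncation error *)

Lemma le_of_le_add_inv (R : realType) (x y K : R) (n : nat) :
  (forall N, (n <= N)%N -> x <= y + K / (N%:R + 2^-1)) -> x <= y.
Proof.
move=> H; apply/ler_addgt0Pr => e e0.
pose N := maxn n (Num.truncn (`|K| / e)).+1.
apply: (le_trans (H N (leq_maxl _ _))); rewrite lerD2l.
have m0 : 0 < N%:R + 2^-1 :> R by rewrite ltr_wpDl.
rewrite ler_pdivrMr// (le_trans (ler_norm K))// mulrC -ler_pdivrMr//.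
have KN : `|K| / e <= N%:R.
  rewrite (le_trans (ltW (truncnS_gt _)))// ler_nat leq_max; apply/orP; right; exact: leqnn.
by rewrite (le_trans KN)// lerDl.
Qed.

(** The factor [cos (pi * k)] stands for the sign [(-1)^k]. *)
Lemma sinc_intB (R : realType) (u : R) (k : nat) : u != k%:R ->
  sinc (pi * (u - k%:R)) = sin (pi * u) * cos (pi * k%:R) / (pi * (u - k%:R)).
Proof.
move=> uk; rewrite /sinc mulf_eq0 subr_eq0 (negbTE uk) (gt_eqF (pi_gt0 R))/=.
by rewrite mulrBr sinB sin_nat_pi mulr0 subr0.
Qed.

Lemma sinc_intD (R : realType) (u : R) (k : nat) : u != - k%:R ->
  sinc (pi * (u - - k%:R)) = sin (pi * u) * cos (pi * k%:R) / (pi * (u + k%:R)).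
Proof.
move=> uk; rewrite /sinc mulf_eq0 subr_eq0 (negbTE uk) (gt_eqF (pi_gt0 R))/= opprK.
by rewrite mulrDr sinD sin_nat_pi mulr0 addr0.
Qed.

(** From [u^2 <= z n^2 <= z k^2]; this is the source of the factor [1 - z] in the tail bounds. *)
Lemma tail_denominator (R : realType) (u z : R) (n k : nat) : z < 1 ->
  u ^+ 2 <= z * n%:R ^+ 2 -> 0 < z -> (n <= k)%N ->
  (1 - z) * k%:R ^+ 2 <= k%:R ^+ 2 - u ^+ 2.
Proof.
move=> z1 uz z0 nk.
have : n%:R ^+ 2 <= k%:R ^+ 2 :> R by rewrite lerXn2r ?nnegrE// ler_nat.
by move=> /(ler_wpM2l (ltW z0)); lra.
Qed.

(** * Tails beyond [n] of the cosine and sine series *)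

Section tail.
Context (R : realType) (u z : R) (n : nat).
Context (u0 : 0 <= u) (z0 : 0 < z) (z1 : z < 1) (n0 : (0 < n)%N).
Context (uz : u ^+ 2 <= z * n%:R ^+ 2).

Let den_gt0 (k : nat) : (n <= k)%N -> 0 < k%:R ^+ 2 - u ^+ 2.
Proof.
move=> nk; apply: lt_le_trans (tail_denominator z1 uz z0 nk).
by rewrite mulr_gt0 ?subr_gt0// exprn_gt0// ltr0n (leq_trans n0 nk).
Qed.

Let u_neq (k : nat) : (n <= k)%N -> u != k%:R.
Proof.
by move=> /den_gt0 h; apply/eqP => uk; move: h; rewrite uk subrr ltxx.
Qed.

Let u_neqN (k : nat) : (n <= k)%N -> u != - k%:R.
Proof.
by move=> /den_gt0 h; apply/eqP => uk; move: h; rewrite uk sqrrN subrr ltxx.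
Qed.

(** Half of [1 / (k - u) + 1 / (k + u)]: up to sign, the weight of the sine terms once [k] is paired
    with [-k]. *)
Let w (k : nat) : R := k%:R / (k%:R ^+ 2 - u ^+ 2).

Let w_ge0 (k : nat) : (n <= k)%N -> 0 <= w k.
Proof. by move=> /den_gt0 h; rewrite divr_ge0// ltW. Qed.

Let wS_le (k : nat) : (n <= k)%N -> w k.+1 <= w k.
Proof.
move=> nk; have d0 := den_gt0 nk; have d1 := den_gt0 (leqW nk).
rewrite /w ler_pdivrMr// mulrAC ler_pdivlMr//.
move: d0 d1 (ler0n R k); rewrite -natr1; move: (k%:R : R) => q d0 d1 q0.
have h : 0 <= q ^+ 2 + q + u ^+ 2 by rewrite !addr_ge0 ?sqr_ge0.
rewrite -subr_ge0.
by have -> : q * ((q + 1) ^+ 2 - u ^+ 2) - (q + 1) * (q ^+ 2 - u ^+ 2) = q ^+ 2 + q + u ^+ 2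
  by ring.
Qed.

(** Pairing leaves [1 / (u - k) + 1 / (u + k) = - 2 u / (k^2 - u^2)], of size at most
    [2 u / ((1 - z) k^2)]; then [1 / k^2 <= 1 / (k - 1) - 1 / k] telescopes. *)
Lemma tail_cos (th : R) (N : nat) : (n <= N)%N ->
  `|sum_sym N (fun k => sinc (pi * (u - k)) * cos (k * th)) -
    sum_sym n (fun k => sinc (pi * (u - k)) * cos (k * th))|
  <= 2 * u / (pi * (1 - z)) * (n%:R^-1 - N%:R^-1).
Proof.
have pi0 := pi_gt0 R.
have C0 : 0 <= 2 * u / (pi * (1 - z)).
  by rewrite divr_ge0 ?mulr_ge0// ltW// subr_gt0.
elim: N => [|N IH].
  by rewrite leqn0 => /eqP n00; have := n0; rewrite n00.
rewrite leq_eqVlt => /predU1P[<-|]; first by rewrite !subrr normr0 mulr0.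
rewrite ltnS => nN; have nN1 := leqW nN.
rewrite sum_symS.
set s := sum_sym N _ in IH *; set s' := sum_sym n _ in IH *.
rewrite (sinc_intB (u_neq nN1)) (sinc_intD (u_neqN nN1)) mulNr cosN addrAC.
apply: (le_trans (ler_normD _ _)); apply: (le_trans (lerD (IH nN) (lexx _))).
have d0 := den_gt0 nN1.
have k0 : 0 < N%:R :> R by rewrite ltr0n (leq_trans n0 nN).
have k1 : 0 < N.+1%:R :> R by rewrite ltr0n.
set kk : R := N.+1%:R in d0 k1 *.
set P := sin (pi * u); set Q := cos (pi * kk); set T := cos (kk * th).
have h1 : u - kk != 0 by rewrite subr_eq0; exact: u_neq nN1.
have h2 : u + kk != 0 by rewrite addr_eq0; exact: u_neqN nN1.
have -> : P * Q / (pi * (u - kk)) * T + P * Q / (pi * (u + kk)) * T =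
    - (P * Q * T) * (2 * u / (pi * (kk ^+ 2 - u ^+ 2))).
  have pin0 : pi != 0 :> R by rewrite gt_eqF.
  move: (gt_eqF d0) => /negbT d0'; clearbody P Q T kk.
  move: (pi : R) pin0 => q q0.
  by field; rewrite d0' q0 h2 h1.
have PQT : `|- (P * Q * T)| <= 1.
  rewrite normrN !normrM -[leRHS]mulr1 ler_pM//.
    rewrite -[leRHS]mulr1 ler_pM ?sin_max// ler_norml.
    by rewrite cos_geN1 cos_le1.
  by rewrite ler_norml cos_geN1 cos_le1.
rewrite normrM.
have e0 : 0 <= 2 * u / (pi * (kk ^+ 2 - u ^+ 2)).
  by rewrite divr_ge0 ?mulr_ge0// ltW.
rewrite [`|2 * u / _|]ger0_norm//.
have step : 2 * u / (pi * (kk ^+ 2 - u ^+ 2)) <=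
    2 * u / (pi * (1 - z)) * (N%:R^-1 - kk^-1).
  have hz : 0 < (1 - z) * kk ^+ 2 by rewrite mulr_gt0 ?subr_gt0 ?exprn_gt0.
  apply: (@le_trans _ _ (2 * u / (pi * ((1 - z) * kk ^+ 2)))).
    rewrite ler_wpM2l ?mulr_ge0// lef_pV2 ?posrE ?(mulr_gt0 pi0 hz) ?(mulr_gt0 pi0 d0)//.
    by rewrite ler_pM2l//; exact: tail_denominator z1 uz z0 nN1.
  have -> : 2 * u / (pi * ((1 - z) * kk ^+ 2)) = 2 * u / (pi * (1 - z)) * kk ^- 2.
    by rewrite (mulrA pi) invfM mulrA.
  rewrite ler_wpM2l// /kk -natr1.
  have -> : N%:R^-1 - (N%:R + 1)^-1 = (N%:R * (N%:R + 1))^-1 :> R.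
    by field; rewrite !gt_eqF// natr1 ltr0n.
  rewrite lef_pV2 ?posrE ?mulr_gt0 ?exprn_gt0 ?natr1//.
  by rewrite expr2 ler_pM2r// ler_nat.
have h3 := ler_pM (normr_ge0 _) e0 PQT step; rewrite mul1r in h3.
apply: (le_trans (lerD (lexx _) h3)); rewrite -mulrDr.
have -> : n%:R^-1 - N%:R^-1 + (N%:R^-1 - kk^-1) = n%:R^-1 - kk^-1 by ring.
exact: lexx.
Qed.

(** The weights [w k] decay only like [1 / k], so cancellation is needed. The sign [(-1)^k] shifts
    [th] by [pi], and the sine of [k (th + pi)] is [e (k - 1) - e k] divided by [2 s]. *)
Lemma tail_sin (th : R) (N : nat) : (n <= N)%N -> 0 < sin ((th + pi) / 2) ->
  `|sum_sym N (fun k => sinc (pi * (u - k)) * sin (k * th)) -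
    sum_sym n (fun k => sinc (pi * (u - k)) * sin (k * th))|
  <= 2 / (pi * (1 - z) * sin ((th + pi) / 2)) / n%:R.
Proof.
set s := sin ((th + pi) / 2) => nN s0.
have pi0 := pi_gt0 R; have pin0 : pi != 0 :> R by rewrite gt_eqF.
pose e (k : nat) := cos ((k%:R + 2^-1) * (th + pi)).
pose D N' := sum_sym N' (fun k => sinc (pi * (u - k)) * sin (k * th)) -
    sum_sym n (fun k => sinc (pi * (u - k)) * sin (k * th)).
rewrite -/(D N).
(* Abel summation; [w] is decreasing and [e] bounded by 1. *)
have [T [DT TN]] : exists T, D N = - (sin (pi * u) / (pi * s)) * T /\
    `|T + w N * e N| <= 2 * w n - w N.
  elim: N nN => [|N IH].
    by rewrite leqn0 => /eqP n00; have := n0; rewrite n00.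
  rewrite leq_eqVlt => /predU1P[<-|].
    exists 0; split; first by rewrite mulr0 /D subrr.
    rewrite add0r normrM ger0_norm ?w_ge0//.
    have -> : 2 * w n - w n = w n * 1 by ring.
    by rewrite ler_wpM2l ?w_ge0// /e ler_norml cos_geN1 cos_le1.
  rewrite ltnS => nN; have nN1 := leqW nN.
  have [T [DT TN]] := IH nN.
  exists (T + w N.+1 * (e N - e N.+1)); split.
    rewrite /D sum_symS addrAC -/(D N) DT [RHS]mulrDr; congr (_ + _).
    rewrite (sinc_intB (u_neq nN1)) (sinc_intD (u_neqN nN1)) mulNr sinN.
    have -> : e N - e N.+1 = 2 * s * (sin (N.+1%:R * th) * cos (pi * N.+1%:R)).
      have -> : sin (N.+1%:R * th) * cos (pi * N.+1%:R) = sin (N.+1%:R * (th + pi)).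
        by rewrite mulrDr sinD [_ * pi]mulrC sin_nat_pi mulr0 addr0.
      rewrite /e /s.
      have -> : (N%:R + 2^-1) * (th + pi) = N.+1%:R * (th + pi) - (th + pi) / 2.
        by rewrite -natr1; move: (pi : R) => q; field.
      have -> : (N.+1%:R + 2^-1) * (th + pi) = N.+1%:R * (th + pi) + (th + pi) / 2.
        by move: (pi : R) => q; field.
      rewrite cosB cosD; ring.
    rewrite /w.
    have h1 : u - N.+1%:R != 0 by rewrite subr_eq0; exact: u_neq nN1.
    have h2 : u + N.+1%:R != 0 by rewrite addr_eq0; exact: u_neqN nN1.
    have d0 : N.+1%:R ^+ 2 - u ^+ 2 != 0 by rewrite gt_eqF// den_gt0.
    have s0' : s != 0 by rewrite gt_eqF.
    move: (sin (pi * u)) (cos (pi * N.+1%:R)) (sin (N.+1%:R * th)) => P Q T'.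
    move: (N.+1%:R : R) h1 h2 d0 => k h1 h2 d0.
    move: (pi : R) pin0 => q q0.
    by field; rewrite h1 h2 d0 s0' q0.
  (* Summation by parts moves the difference from [e] to [w]. The step costs at most [w N - w N.+1],
     exactly the growth of the bound [2 * w n - w N]. *)
  have -> : T + w N.+1 * (e N - e N.+1) + w N.+1 * e N.+1 =
     (T + w N * e N) - (w N - w N.+1) * e N by ring.
  have wd : 0 <= w N - w N.+1 by rewrite subr_ge0 wS_le.
  have : `|(w N - w N.+1) * e N| <= w N - w N.+1.
    rewrite normrM ger0_norm// -[leRHS]mulr1 ler_wpM2l//.
    by rewrite /e ler_norml cos_geN1 cos_le1.
  have := ler_normB (T + w N * e N) ((w N - w N.+1) * e N); lra.
have Tle : `|T| <= 2 * w n.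
  have -> : T = (T + w N * e N) - w N * e N by ring.
  have : `|w N * e N| <= w N.
    rewrite normrM ger0_norm ?w_ge0// -[leRHS]mulr1 ler_wpM2l ?w_ge0//.
    by rewrite /e ler_norml cos_geN1 cos_le1.
  have := ler_normB (T + w N * e N) (w N * e N); lra.
have nR : 0 < n%:R :> R by rewrite ltr0n.
have z1' : 0 < 1 - z by rewrite subr_gt0.
have wn : w n <= ((1 - z) * n%:R)^-1.
  rewrite /w ler_pdivrMr ?den_gt0// mulrC ler_pdivlMr ?mulr_gt0//.
  by have := tail_denominator z1 uz z0 (leqnn n); lra.
have ps0 : 0 < pi * s by rewrite mulr_gt0.
have ss : `|- (sin (pi * u) / (pi * s))| <= (pi * s)^-1.
  by rewrite normrN normrM normfV [`|pi * s|]gtr0_norm// ler_piMl ?invr_ge0 ?(ltW ps0)// sin_max.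
rewrite DT normrM.
have := ler_pM (normr_ge0 _) (normr_ge0 _) ss Tle => /le_trans; apply.
have -> : 2 / (pi * (1 - z) * s) / n%:R = (pi * s)^-1 * (2 * ((1 - z) * n%:R)^-1).
  move: (gt_eqF nR) (gt_eqF s0) (gt_eqF z1') => /negbT n' /negbT s' /negbT zz.
  by move: (pi : R) pin0 => q q0; field; rewrite n' s' zz q0.
by rewrite ler_wpM2l ?invr_ge0 ?(ltW ps0)// ler_wpM2l.
Qed.
End tail.

(** Since [k th = u th - th (u - k)], the sums are those of [sampling_series_cvg] rotated by the
    angle [u th]. They converge to [cos (u th)] and [sin (u th)], so the remainder is the limit of
    the tails [n < |k| <= N]. *)
Lemma sampling_remainder_nonneg (R : realType) (u z th : R) (n : nat) :
  0 <= u -> 0 < z -> z < 1 -> (0 < n)%N -> u ^+ 2 <= z * n%:R ^+ 2 ->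
  0 <= th -> th < pi ->
  `|cos (u * th) - sum_sym n (fun k => sinc (pi * (u - k)) * cos (k * th))|
    <= 2 * u / (pi * (1 - z)) / n%:R /\
  `|sin (u * th) - sum_sym n (fun k => sinc (pi * (u - k)) * sin (k * th))|
    <= 2 / (pi * (1 - z) * sin ((th + pi) / 2)) / n%:R.
Proof.
move=> u0 z0 z1 n0 uz th0 thpi.
have pi0 := pi_gt0 R.
have [K HK] := sampling_series_cvg u th0 thpi.
have s0 : 0 < sin ((th + pi) / 2) by apply: sin_gt0_pi; lra.
pose a N := sum_sym N (fun k => sinc (pi * (u - k)) * cos (th * (u - k))).
pose b N := sum_sym N (fun k => sinc (pi * (u - k)) * sin (th * (u - k))).
have cE N : sum_sym N (fun k => sinc (pi * (u - k)) * cos (k * th)) =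
    cos (u * th) * a N + sin (u * th) * b N.
  rewrite -!sum_symZ -sum_symD; apply: eq_sum_sym => k.
  have -> : k * th = u * th - th * (u - k) by ring.
  by rewrite cosB; ring.
have sE N : sum_sym N (fun k => sinc (pi * (u - k)) * sin (k * th)) =
    sin (u * th) * a N - cos (u * th) * b N.
  rewrite -!sum_symZ -sum_symB; apply: eq_sum_sym => k.
  have -> : k * th = u * th - th * (u - k) by ring.
  by rewrite sinB; ring.
have cos_le (x : R) : `|cos x| <= 1 by rewrite ler_norml cos_geN1 cos_le1.
have comb (p q x y : R) : `|p| <= 1 -> `|q| <= 1 -> `|p * x + q * y| <= `|x| + `|y|.
  move=> p1 q1; rewrite (le_trans (ler_normD _ _))// !normrM.
  by rewrite lerD// ler_piMl.
have two N : K / (N%:R + 2^-1) + K / (N%:R + 2^-1) = (2 * K) / (N%:R + 2^-1) by ring.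
have nN_le (N : nat) : (n <= N)%N -> n%:R^-1 - N%:R^-1 <= n%:R^-1 :> R.
  by move=> _; rewrite gerBl invr_ge0.
split; apply: (@le_of_le_add_inv R _ _ (2 * K) n) => N nN; have [Ha Hb] := HK N.
  have h : `|cos (u * th) - sum_sym N (fun k => sinc (pi * (u - k)) * cos (k * th))|
      <= 2 * K / (N%:R + 2^-1).
    rewrite cE.
    have -> : cos (u * th) - (cos (u * th) * a N + sin (u * th) * b N) =
      cos (u * th) * (1 - a N) + (- sin (u * th)) * b N by ring.
    rewrite (le_trans (comb _ _ _ _ (cos_le _) _)) ?normrN ?sin_max//.
    by rewrite -two lerD.
  have tl := tail_cos u0 z0 z1 n0 uz th nN.
  have C0 : 0 <= 2 * u / (pi * (1 - z)).
    by rewrite divr_ge0 ?mulr_ge0// ltW// subr_gt0.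
  have := le_trans tl (ler_wpM2l C0 (nN_le N nN)).
  move: h; set S := sum_sym N _; set S' := sum_sym n _ => h h'.
  have -> : cos (u * th) - S' = (cos (u * th) - S) + (S - S') by ring.
  by rewrite [leRHS]addrC (le_trans (ler_normD _ _))// lerD.
have h : `|sin (u * th) - sum_sym N (fun k => sinc (pi * (u - k)) * sin (k * th))|
    <= 2 * K / (N%:R + 2^-1).
  rewrite sE.
  have -> : sin (u * th) - (sin (u * th) * a N - cos (u * th) * b N) =
    sin (u * th) * (1 - a N) + cos (u * th) * b N by ring.
  rewrite (le_trans (comb _ _ _ _ (sin_max _) (cos_le _)))//.
  by rewrite -two lerD.
have tl := tail_sin z0 z1 n0 uz nN s0.
move: h tl; set S := sum_sym N _; set S' := sum_sym n _ => h h'.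
have -> : sin (u * th) - S' = (sin (u * th) - S) + (S - S') by ring.
by rewrite [leRHS]addrC (le_trans (ler_normD _ _))// lerD.
Qed.

(** The left side is the squared modulus of [e^(i t lam)] minus its sampling sum. Rescaling by [u]
    and [th] makes the sampling step 1, and the modulus is at most the sum of the two tail
    bounds. *)
Lemma sampling_remainder (R : realType) (om L z t lam : R) (n : nat) :
  0 < L -> L < om -> 0 < z -> z < 1 -> (0 < n)%N -> 0 <= t ->
  (om * t / pi) ^+ 2 <= z * n%:R ^+ 2 -> `|lam| <= L ->
  (cos (t * lam) - sum_sym n (fun k => sinc (om * (t - k * pi / om)) *
      cos (k * pi / om * lam))) ^+ 2 +
  (sin (t * lam) - sum_sym n (fun k => sinc (om * (t - k * pi / om)) *
      sin (k * pi / om * lam))) ^+ 2 <=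
  ((4 * om * t / (pi ^+ 2 * (1 - z)) +
    4 * (z + 1 + n%:R^-1) / (pi * (1 - z) ^+ 2 * (1 - L / om))) / n%:R) ^+ 2.
Proof.
move=> L0 Lom z0 z1 n0 t0 uz lamL.
have om0 : 0 < om by apply: lt_trans Lom.
have pi0 := pi_gt0 R; have pi2 := pi_ge2 R.
have pin0 : pi != 0 :> R by rewrite gt_eqF.
have omn0 : om != 0 by rewrite gt_eqF.
wlog lam0 : lam lamL / 0 <= lam.
  move=> H; have [/H|/ltW lam0] := leP 0 lam; first exact.
  have := H (- lam); rewrite normrN oppr_ge0 => /(_ lamL lam0).
  rewrite !mulrN cosN sinN.
  rewrite (eq_sum_sym _ (h2 := fun k => sinc (om * (t - k * pi / om)) *
      cos (k * pi / om * lam))); last by move=> k; rewrite mulrN cosN.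
  rewrite (eq_sum_sym _ (h1 := fun k => _ * sin _) (h2 := fun k =>
      -1 * (sinc (om * (t - k * pi / om)) * sin (k * pi / om * lam)))); last first.
    by move=> k; rewrite mulrN sinN; ring.
  by rewrite sum_symZ mulN1r -[X in _ + X ^+ 2 <= _]opprD sqrrN.
pose u := om * t / pi; pose th := pi * lam / om.
have u0 : 0 <= u by rewrite divr_ge0 ?mulr_ge0// ltW.
have th0 : 0 <= th by rewrite divr_ge0 ?mulr_ge0// ltW.
rewrite ger0_norm// in lamL.
have thL : th <= pi * (L / om).
  by rewrite /th -mulrA ler_pM2l// ler_pM2r ?invr_gt0.
have rho1 : 0 < 1 - L / om by rewrite subr_gt0 ltr_pdivrMr// mul1r.
have thpi : th < pi.
  by apply: (le_lt_trans thL); rewrite gtr_pMr// -subr_gt0.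
have [hc hs] := sampling_remainder_nonneg u0 z0 z1 n0 uz th0 thpi.
have tE : t * lam = u * th.
  by rewrite /u /th; move: (pi : R) pin0 => q q0; field; rewrite omn0 q0.
have sE k : sinc (om * (t - k * pi / om)) = sinc (pi * (u - k)).
  congr sinc; rewrite /u; move: (pi : R) pin0 => q q0; field; by rewrite ?omn0 ?q0.
have kE k : k * pi / om * lam = k * th.
  by rewrite /th; ring.
rewrite (eq_sum_sym _ (h2 := fun k => sinc (pi * (u - k)) * cos (k * th))); last first.
  by move=> k; rewrite sE kE.
rewrite [X in sin (t * lam) - X](eq_sum_sym _ (h2 := fun k => sinc (pi * (u - k)) * sin (k * th))); last first.
  by move=> k; rewrite sE kE.
rewrite tE; move: hc hs.
set a := cos _ - _; set b := sin _ - _; set s := sin _.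
set eb := _ / n%:R; set ea := _ / n%:R => ha hb.
(* [sin_half_away] at [th + pi], followed by [th <= pi * (L / om)] and [pi >= 2]. *)
have s_ge : (1 - L / om) / 2 <= s.
  apply: (@le_trans _ _ ((pi - th) / 4)).
    apply: (@le_trans _ _ (pi * (1 - L / om) / 4)).
      have := ler_wpM2r (ltW rho1) pi2; lra.
    by move: thL; rewrite mulrBr mulr1; lra.
  by apply: sin_half_away => //; lra.
have nR : 0 < n%:R :> R by rewrite ltr0n.
have z1' : 0 < 1 - z by rewrite subr_gt0.
have ea_ge0 : 0 <= ea by exact: le_trans (normr_ge0 _) ha.
have eb_ge0 : 0 <= eb by exact: le_trans (normr_ge0 _) hb.
apply: (@le_trans _ _ ((ea + eb) ^+ 2)).
  have : a ^+ 2 <= ea ^+ 2 by rewrite -(real_normK (num_real a)) lerXn2r ?nnegrE.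
  have : b ^+ 2 <= eb ^+ 2 by rewrite -(real_normK (num_real b)) lerXn2r ?nnegrE.
  by have := mulr_ge0 ea_ge0 eb_ge0; lra.
have s0 : 0 < s by apply: lt_le_trans s_ge; rewrite divr_gt0.
have h1 : 2 * u / (pi * (1 - z)) <= 4 * om * t / (pi ^+ 2 * (1 - z)).
  have -> : 4 * om * t / (pi ^+ 2 * (1 - z)) = 4 * u / (pi * (1 - z)).
    rewrite /u; move: (gt_eqF z1') (pi : R) pin0 => /negbT zz q q0.
    by field; rewrite zz q0.
  rewrite ler_wpM2r ?invr_ge0 ?mulr_ge0 ?(ltW z1') ?(ltW pi0)// ler_wpM2r//.
  by rewrite ler_nat.
(* First [s_ge] is inserted; then a factor [(z + 1 + 1 / n) / (1 - z)], which is at least 1, gives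
   the constant of [C_n]. *)
have h2 : 2 / (pi * (1 - z) * s) <=
    4 * (z + 1 + n%:R^-1) / (pi * (1 - z) ^+ 2 * (1 - L / om)).
  have pz0 : 0 < pi * (1 - z) by rewrite mulr_gt0.
  apply: (@le_trans _ _ (4 / (pi * (1 - z) * (1 - L / om)))).
    rewrite ler_pdivrMr ?mulr_gt0// mulrAC ler_pdivlMr ?mulr_gt0//.
    by have := ler_wpM2l (ltW pz0) s_ge; lra.
  rewrite ler_pdivrMr ?mulr_gt0// mulrAC ler_pdivlMr ?mulr_gt0 ?exprn_gt0//.
  have n0' : 0 <= n%:R^-1 :> R by rewrite invr_ge0 ltW.
  have P0 : 0 <= pi * (1 - z) * (1 - L / om) by rewrite mulr_ge0// ltW.
  have h : 1 - z <= z + 1 + n%:R^-1 by lra.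
  have := ler_wpM2l P0 h; move: (1 - L / om) => rho.
  by rewrite expr2; move: (pi : R) => q; lra.
have A0 : 0 <= 2 * u / (pi * (1 - z)).
  by rewrite divr_ge0 ?(mulr_ge0 _ u0)// mulr_ge0 ?(ltW z1') ?(ltW pi0).
have B0 : 0 <= 2 / (pi * (1 - z) * s).
  by rewrite divr_ge0// mulr_ge0 ?(ltW s0)// mulr_ge0 ?(ltW z1') ?(ltW pi0).
have H : ea + eb <= (4 * om * t / (pi ^+ 2 * (1 - z)) +
    4 * (z + 1 + n%:R^-1) / (pi * (1 - z) ^+ 2 * (1 - L / om))) / n%:R.
  by rewrite /ea /eb -mulrDl ler_pM2r ?invr_gt0// lerD.
have e0 : 0 <= ea + eb by rewrite addr_ge0.
by rewrite lerXn2r ?nnegrE// (le_trans e0 H).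
Qed.

(** * Second moments of band-limited processes *)

Section Rintegral_sum.
Context d (T : measurableType d) (R : realType) (mu : {measure set T -> \bar R}).
Context (D : set T) (mD : measurable D).

Lemma integrable_scaled_sum (I : Type) (s : seq I) (c : I -> R) (f : I -> T -> R) :
  (forall i, mu.-integrable D (EFin \o f i)) ->
  mu.-integrable D (EFin \o (fun x => \sum_(i <- s) c i * f i x)).
Proof.
move=> fi.
under [X in _.-integrable _ X]eq_fun do rewrite /= -sumEFin.
by apply: integrable_sum => // i _; exact: (integrableZl mD (c i) (fi i)).
Qed.

Lemma Rintegral_scaled_sum (I : Type) (s : seq I) (c : I -> R) (f : I -> T -> R) :
  (forall i, mu.-integrable D (EFin \o f i)) ->
  \int[mu]_(x in D) (\sum_(i <- s) c i * f i x) =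
  \sum_(i <- s) c i * \int[mu]_(x in D) f i x.
Proof.
move=> fi; elim: s => [|i s IH].
  rewrite big_nil; under eq_Rintegral do rewrite big_nil.
  by rewrite Rintegral_cst// mul0r.
rewrite big_cons; under eq_Rintegral do rewrite big_cons.
rewrite RintegralD//; last exact: integrable_scaled_sum.
  by rewrite IH RintegralZl.
exact: (integrableZl mD (c i) (fi i)).
Qed.

End Rintegral_sum.

Lemma sqr_sum (R : realType) (m : nat) (l x : 'I_m -> R) :
  (\sum_(i < m) l i * x i) ^+ 2 =
  \sum_(p : 'I_m * 'I_m) l p.1 * l p.2 * (x p.1 * x p.2).
Proof.
rewrite expr2 big_distrlr/= pair_bigA/=.
by apply: eq_bigr => p _; ring.
Qed.

(** Used to see that the spectral measure of [[-L, L[] is finite, this interval lying in []-L - 1,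
    L]]. *)
Lemma lebesgue_stieltjes_itvoc (R : realType) (F : cumulative R R) (a b : R) :
  lebesgue_stieltjes_measure F `]a, b]%classic = wlength F `]a, b]%classic.
Proof.
rewrite /lebesgue_stieltjes_measure/= /measure_extension/=.
by rewrite measurable_mu_extE//; exact: is_ocitv.
Qed.

(** The spectral isometry in real form: as [cos (a - b) = cos a cos b + sin a sin b], the quadratic
    form is the integral of the squared modulus bounded by [M], and [B 0] is the total mass. In the
    application [g] is [id]. *)
Lemma spectral_form_le d (T : measurableType d) (R : realType)
    (mu : {measure set T -> \bar R}) (D : set T) (mD : measurable D) (g : T -> R)
    (B : R -> R) (M : R) (m : nat) (t l : 'I_m -> R) :
  (forall tau : R, mu.-integrable D (EFin \o (fun x => cos (tau * g x)))) ->
  (forall tau : R, B tau = \int[mu]_(x in D) cos (tau * g x)) ->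
  (forall x, D x -> (\sum_(i < m) l i * cos (t i * g x)) ^+ 2 +
    (\sum_(i < m) l i * sin (t i * g x)) ^+ 2 <= M) ->
  \sum_(p : 'I_m * 'I_m) l p.1 * l p.2 * B (t p.1 - t p.2) <= M * B 0.
Proof.
move=> cosI BE HM.
pose c (p : 'I_m * 'I_m) := l p.1 * l p.2.
under eq_bigr do rewrite BE.
have fi (p : 'I_m * 'I_m) := cosI (t p.1 - t p.2).
rewrite -(Rintegral_scaled_sum mD (index_enum _) c fi).
rewrite (BE 0) -(RintegralZl M mD (cosI 0)).
apply: le_Rintegral => //.
- exact: (integrable_scaled_sum mD (index_enum _) c fi).
- exact: (integrableZl mD M (cosI 0)).
move=> x Dx; rewrite mul0r cos0 mulr1 (le_trans _ (HM x Dx))//.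
rewrite !sqr_sum -big_split/= le_eqVlt; apply/orP; left; apply/eqP.
by apply: eq_bigr => p _; rewrite /c mulrBl cosB; ring.
Qed.

Section second_moment.
Context (R : realType) (d : measure_display) (Omega : measurableType d).
Context (P : probability Omega R) (X : R -> {RV P >-> R}) (B : R -> R).
Context (hstat : stationary X B).

Lemma integrable_sqr_stationary (t : R) : P.-integrable setT (EFin \o (fun w => X t w ^+ 2)).
Proof.
apply/integrableP; split.
  by apply/measurable_EFinP; apply: measurable_funX.
have [_ /(_ t 0)] := hstat; rewrite addr0 unlock => h.
under eq_integral do rewrite /= ger0_norm ?sqr_ge0// expr2.
by rewrite h ltry.
Qed.

Lemma integrable_mul_stationary (s t : R) :
  P.-integrable setT (EFin \o (fun w => X s w * X t w)).
Proof.
have hs := integrable_sqr_stationary s; have ht := integrable_sqr_stationary t.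
have := integrableD measurableT hs ht; apply: le_integrable => //.
  by apply/measurable_EFinP; apply: measurable_funM.
move=> w _ /=; rewrite lee_fin [leRHS]ger0_norm ?addr_ge0 ?sqr_ge0//.
rewrite ler_norml; have := sqr_ge0 (X s w + X t w); have := sqr_ge0 (X s w - X t w).
have := sqr_ge0 (X s w); have := sqr_ge0 (X t w).
by rewrite sqrrB sqrrD; lra.
Qed.

Lemma second_moment_stationary (m : nat) (t l : 'I_m -> R) :
  'E_P[fun w => ((\sum_(i < m) l i * X (t i) w) ^+ 2)%R]%E =
  (\sum_(p : 'I_m * 'I_m) l p.1 * l p.2 * B (t p.1 - t p.2))%:E.
Proof.
have fi (p : 'I_m * 'I_m) :
    P.-integrable setT (EFin \o (fun w => X (t p.1) w * X (t p.2) w)).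
  exact: integrable_mul_stationary.
have RE (p : 'I_m * 'I_m) :
    \int[P]_w (X (t p.1) w * X (t p.2) w) = B (t p.1 - t p.2).
  have [_ /(_ (t p.2) (t p.1 - t p.2))] := hstat.
  by rewrite addrC subrK unlock /Rintegral => ->.
rewrite unlock.
under eq_integral do rewrite sqr_sum.
rewrite -[LHS]fineK; last first.
  have h := @integrable_scaled_sum _ _ _ P setT measurableT _ (index_enum _)
    (fun p : 'I_m * 'I_m => l p.1 * l p.2) _ fi.
  exact: integrable_fin_num h.
congr (_%:E).
rewrite -[LHS]/(\int[P]_w (\sum_(p : 'I_m * 'I_m) l p.1 * l p.2 * (X (t p.1) w * X (t p.2) w))).
rewrite (@Rintegral_scaled_sum _ _ _ P setT measurableT _ (index_enum _)
    (fun p : 'I_m * 'I_m => l p.1 * l p.2) _ fi).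
by apply: eq_bigr => p _; rewrite RE.
Qed.

Lemma second_moment_bandlimited_le (L M : R) (m : nat) (t l : 'I_m -> R) :
  bandlimited B L ->
  (forall lam, `|lam| <= L ->
    (\sum_(i < m) l i * cos (t i * lam)) ^+ 2 +
    (\sum_(i < m) l i * sin (t i * lam)) ^+ 2 <= M) ->
  ('E_P[fun w => ((\sum_(i < m) l i * X (t i) w) ^+ 2)%R] <= (M * B 0)%:E)%E.
Proof.
move=> [F HF] HM; rewrite second_moment_stationary lee_fin.
pose mu : {measure set (measurableTypeR R) -> \bar R} := lebesgue_stieltjes_measure F.
have mI : measurable (`[- L, L[ : set R) by exact: measurable_itv.
have muI : (mu `[(- L)%R, L[%classic < +oo)%E.
  apply: (@le_lt_trans _ _ (mu `](- L - 1)%R, L]%classic)).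
    apply: le_measure; rewrite ?inE//.
    by move=> x /=; rewrite !in_itv/= => /andP[h1 h2]; apply/andP; split; lra.
  have -> : mu `](- L - 1)%R, L]%classic = wlength F `](- L - 1)%R, L]%classic.
    exact: lebesgue_stieltjes_itvoc.
  have [h|h] := leP (- L - 1) L; first by rewrite wlength_itv_bnd// ltry.
  by rewrite set_itv_ge ?bnd_simp -?leNgt ?(ltW h)// wlength0.
have cosI (tau : R) : mu.-integrable `[- L, L[ (EFin \o (fun x => cos (tau * x))).
  apply: measurable_bounded_integrable => //.
    apply: measurable_funTS; apply: continuous_measurable_fun => x.
    apply: (@continuous_comp _ _ _ (fun x => tau * x) cos); last exact: continuous_cos.
    exact: mulrl_continuous.
  exists 1; split => // x x1 y _ /=; apply: (le_trans _ (ltW x1)).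
  by rewrite ler_norml cos_geN1 cos_le1.
have BE (tau : R) : B tau = \int[mu]_(x in `[- L, L[) cos (tau * x) by have [] := HF tau.
apply: (@spectral_form_le _ _ _ mu `[- L, L[%classic mI id B M m t l cosI BE).
move=> x /=; rewrite in_itv/= => /andP[x1 x2].
by apply: HM; rewrite ler_norml x1 (ltW x2).
Qed.

End second_moment.

(** * Exponential moments *)

Lemma N_function_le (R : realType) (phi : R -> R) (x y : R) :
  N_function phi -> (forall x, 0 <= phi x) -> 0 <= x -> x <= y -> phi x <= phi y.
Proof.
move=> [_ [_ [_ [inc [phi0 _]]]]] phi_ge0; rewrite !le_eqVlt => /predU1P[<-|x0].
  by move=> _; rewrite phi0 -le_eqVlt phi_ge0.
move=> /predU1P[->|xy]; first by rewrite eqxx.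
by apply/orP; right; apply: inc; rewrite ?in_itv/= ?x0 ?(lt_trans x0 xy).
Qed.

(** As [phi b / b] tends to infinity, [phi b >= y] for some [b >= 1], and the intermediate value
    theorem puts [y] in the image of [[0, +oo[], where [pinv] is a right inverse. *)
Lemma N_function_pinv (R : realType) (phi : R -> R) (y : R) :
  N_function phi -> 0 <= y ->
  0 <= pinv (`[0, +oo[ : set R) phi y /\ phi (pinv (`[0, +oo[ : set R) phi y) = y.
Proof.
move=> [cont [_ [_ [_ [phi0 [_ infty]]]]]] y0.
have ysurj : (phi @` `[0, +oo[) y.
  have [b [b1 yb]] : exists b, 1 <= b /\ y <= phi b / b.
    have /cvgryPge /(_ y) h := infty.
    have h1 : \forall x \near +oo, 1 <= x :> R by exact: nbhs_pinfty_ge.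
    near +oo_R => b; exists b; split; near: b; [exact: h1|exact: h].
  have b0 : 0 < b by apply: lt_le_trans b1.
  have yphi : y <= phi b.
    by move: yb; rewrite ler_pdivlMr//; apply: le_trans; rewrite ler_peMr.
  have [||c] := @IVT _ phi 0 b y (ltW b0).
  - exact: continuous_subspaceT.
  - by rewrite phi0 ge_min le_max y0 yphi orbT.
  rewrite in_itv/= => /andP[c0 _] cy; exists c => //=.
  by rewrite in_itv/= c0.
split; last by apply: pinvK; rewrite inE.
have sub : set_surj (`[0, +oo[ : set R) (phi @` `[0, +oo[) phi by [].
have := surjpinv_image_sub sub.
move=> /(_ (fun=> point) (pinv (`[0, +oo[ : set R) phi y)).
by rewrite /= in_itv/= andbT; apply; exists y.
Unshelve. all: by end_near. Qed.

Section exponential_moments.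
Context (R : realType) (d : measure_display) (Omega : measurableType d).
Context (P : probability Omega R).

(** This class is stable under linear combinations, by [a b <= a^2 + b^2] for exponentials. It makes
    the expectation inside [tau_norm] finite, so that [fine] loses nothing. *)
Definition exp_integrable (xi : Omega -> R) : Prop :=
  measurable_fun setT xi /\
  forall l : R, P.-integrable setT (EFin \o (fun w => expR (l * xi w))).

Lemma exp_integrable_integrable (xi : Omega -> R) :
  exp_integrable xi -> P.-integrable setT (EFin \o xi).
Proof.
move=> [mxi xiI]; have := integrableD measurableT (xiI 1) (xiI (-1)).
apply: le_integrable => //; first exact/measurable_EFinP.
move=> w _ /=; rewrite lee_fin [leRHS]ger0_norm ?addr_ge0 ?expR_ge0//.
rewrite mul1r mulN1r ler_norml.
have := expR_ge1Dx (xi w); have := expR_ge1Dx (- xi w).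
by have := expR_ge0 (xi w); have := expR_ge0 (- xi w); lra.
Qed.

Lemma exp_integrableD (xi eta : Omega -> R) :
  exp_integrable xi -> exp_integrable eta -> exp_integrable (fun w => xi w + eta w).
Proof.
move=> [mxi xiI] [meta etaI]; split; first exact: measurable_funD.
move=> l; have := integrableD measurableT (xiI (2 * l)) (etaI (2 * l)).
apply: le_integrable => //.
  apply/measurable_EFinP; apply: measurableT_comp => //.
  by apply: measurable_funM => //; exact: measurable_funD.
move=> w _ /=; rewrite lee_fin !ger0_norm ?addr_ge0 ?expR_ge0//.
have dbl (x : R) : expR (2 * l * x) = expR (l * x) ^+ 2.
  by rewrite -expRM_natl; congr expR; ring.
rewrite !dbl mulrDr expRD.
have := expR_ge0 (l * xi w); have := expR_ge0 (l * eta w).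
move: (expR _) (expR _) => a b a0 b0.
have := sqr_ge0 (a - b); have := mulr_ge0 a0 b0; rewrite sqrrB; lra.
Qed.

Lemma exp_integrable_sum (m : nat) (l : 'I_m -> R) (xi : 'I_m -> Omega -> R) :
  (forall i, exp_integrable (xi i)) ->
  exp_integrable (fun w => \sum_(i < m) l i * xi i w).
Proof.
move=> xiI.
have scal i : exp_integrable (fun w => l i * xi i w).
  have [mi ii] := xiI i; split; first exact: measurable_funM.
  by move=> c; have := ii (c * l i); congr (_.-integrable _ _); apply/funext => w /=;
    rewrite mulrA.
elim: m l xi xiI scal => [|m IH] l xi xiI scal.
  under eq_fun do rewrite big_ord0.
  split => // c; under [X in _.-integrable _ (_ \o X)]eq_fun do rewrite mulr0 expR0.
  exact: finite_measure_integrable_cst.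
under eq_fun do rewrite big_ord_recl.
by apply: exp_integrableD => //; apply: IH.
Qed.

(** Undoing [pinv] needs a nonnegative argument, that is, [E exp (l xi) >= 1]; this follows from
    [exp x >= 1 + x] and the zero mean. The case [l = 0], absent from the supremum, is treated
    apart. *)
Lemma mgf_le_of_tau_norm (phi : R -> R) (xi : Omega -> R) (c l : R) :
  N_function phi -> (forall x, 0 <= phi x) ->
  exp_integrable xi -> ('E_P[xi] = 0)%E -> (tau_norm P phi xi <= c%:E)%E ->
  ('E_P[fun w => expR (l * xi w)] <= (expR (phi (c * `|l|)))%:E)%E.
Proof.
move=> Nphi phi_ge0 expI E0 tau_le.
have xiI := exp_integrable_integrable expI.
have E1 : (1 <= 'E_P[fun w => expR (l * xi w)])%E.
  have e0 : \int[P]_w xi w = 0 by move: E0; rewrite unlock /Rintegral => ->.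
  have xlI := integrableZl measurableT l xiI.
  have oneI := finite_measure_integrable_cst P (1 : R) measurableT.
  have : \int[P]_w (1 + l * xi w) <= \int[P]_w (expR (l * xi w)).
    apply: le_Rintegral => //.
    - exact: (integrableD measurableT oneI xlI).
    - exact: expI.2.
    - by move=> w _; exact: expR_ge1Dx.
  rewrite (RintegralD measurableT oneI xlI) (RintegralZl l measurableT xiI) e0.
  rewrite mulr0 addr0 Rintegral_cst// mul1r.
  rewrite -[fine _]/(fine (P setT)) probability_setT/= /Rintegral => h.
  rewrite unlock -[leRHS]fineK ?lee_fin//.
  exact: integrable_fin_num (expI.2 l).
have Efin : 'E_P[fun w => expR (l * xi w)]%E \is a fin_num.
  by rewrite unlock; exact: integrable_fin_num (expI.2 l).
have fE : 1 <= fine 'E_P[fun w => expR (l * xi w)]%E by rewrite -lee_fin fineK.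
have [->|l0] := eqVneq l 0.
  rewrite normr0 mulr0; under [X in 'E_P[X]%E]eq_fun do rewrite mul0r expR0.
  by rewrite expectation_cst lee_fin -expR0 ler_expR.
set y := ln (fine 'E_P[fun w => expR (l * xi w)]%E).
have y0 : 0 <= y by rewrite /y ln_ge0.
have [pinv0 pinvE] := N_function_pinv Nphi y0.
have : ((pinv (`[0, +oo[ : set R) phi y / `|l|)%:E <= tau_norm P phi xi)%E.
  by apply: ereal_sup_ubound; exists l => //=; exact/eqP.
move=> /le_trans /(_ tau_le); rewrite lee_fin ler_pdivrMr ?normr_gt0// => ple.
rewrite -(fineK Efin) lee_fin -[leLHS]lnK ?posrE ?(lt_le_trans _ fE)//.
by rewrite ler_expR -/y -pinvE N_function_le.
Qed.

End exponential_moments.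

(** * Deviations of the L_p norm *)

(** As [h] is measurable only over [D], it is extended by 0, which reduces everything to Tonelli's
    theorem on the whole product. *)
Lemma tonelli_within d1 d2 (T1 : measurableType d1) (T2 : measurableType d2) (R : realType)
    (m1 : {sigma_finite_measure set T1 -> \bar R})
    (m2 : {sigma_finite_measure set T2 -> \bar R})
    (D : set T1) (h : T1 * T2 -> \bar R) :
  measurable D -> measurable_fun (D `*` setT) h -> (forall z, (0 <= h z)%E) ->
  [/\ forall w, measurable_fun D (fun t => h (t, w)),
      measurable_fun setT (fun w => \int[m1]_(t in D) h (t, w))%E,
      measurable_fun D (fun t => \int[m2]_w h (t, w))%E &
      (\int[m2]_w \int[m1]_(t in D) h (t, w) = \int[m1]_(t in D) \int[m2]_w h (t, w))%E].
Proof.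
move=> mD mh h0.
have mDT : measurable (D `*` [set: T2]) by apply: measurableX.
pose g := h \_ (D `*` setT).
have mg : measurable_fun setT g.
  by apply/(measurable_restrict _ mDT measurableT); rewrite setTI.
have g0 z : (0 <= g z)%E by rewrite /g patchE; case: ifP.
have gl w : (fun t => g (t, w)) = (fun t => h (t, w)) \_ D.
  apply/funext => t; rewrite /g !patchE.
  by have -> : ((t, w) \in D `*` [set: T2]) = (t \in D) by rewrite in_setX in_setT andbT.
have gE w : (\int[m1]_(t in D) h (t, w) = \int[m1]_t g (t, w))%E.
  by rewrite integral_mkcond -gl.
split.
- move=> w; apply: (@measurable_comp _ _ _ _ _ _ (D `*` setT) h) => //.
    by move=> _ [t Dt <-]; split.
  exact: measurable_funTS (pair2_measurable w).
- under eq_fun do rewrite gE.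
  exact: (measurable_fun_fubini_tonelli_G (m1 := m1)).
- apply: (eq_measurable_fun (fun t => \int[m2]_w g (t, w))%E).
    by move=> t tD; apply: eq_integral => w _; have := congr1 (@^~ t) (gl w);
      rewrite /= patchE tD.
  by apply: measurable_funTS; exact: (measurable_fun_fubini_tonelli_F (m2 := m2)).
under eq_integral do rewrite gE.
rewrite -fubini_tonelli// [RHS]integral_mkcond; apply: eq_integral => t _.
rewrite patchE; case: ifPn => tD.
  by apply: eq_integral => w _; have := congr1 (@^~ t) (gl w); rewrite /= patchE tD.
by apply: integral0_eq => w _; have := congr1 (@^~ t) (gl w); rewrite /= patchE (negbTE tD).
Qed.

Lemma powR_div (R : realType) (a b p : R) : 0 <= a -> 0 <= b ->
  (a / b) `^ p = a `^ p / b `^ p.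
Proof.
move=> a0 b0; rewrite powRM ?invr_ge0//.
by rewrite -(powR_inv1 b0) -powRrM mulN1r powRN.
Qed.

(** Bernoulli's inequality [(1 + s)^a >= 1 + a s] at [1 + s = e^c]. It combines
    [e^((a - 1) c) >= 1 + (a - 1) c] with [e^c (1 - c) <= 1]. *)
Lemma bernoulli_expR (R : realType) (a c : R) : 1 <= a ->
  1 + a * (expR c - 1) <= expR (a * c).
Proof.
move=> a1.
have -> : a * c = c + (a - 1) * c by ring.
rewrite expRD; have h1 := expR_ge1Dx ((a - 1) * c); have h2 := expR_ge1Dx (- c).
have e0 := expR_gt0 c.
have h3 : expR c * (1 - c) <= 1.
  have := ler_wpM2l (ltW e0) h2; rewrite -expRD subrr expR0; apply: le_trans.
  by rewrite lexx.
have a0 : 0 <= a - 1 by rewrite subr_ge0.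
have := ler_wpM2l (ltW e0) h1; have := ler_wpM2l a0 h3; lra.
Qed.

(** Bernoulli with [a = v x / p], at least 1 by [p <= v x], and [c = p (y / x - 1)], for which
    [e^c >= (y / x)^p]. *)
Lemma expR_ge_powR (R : realType) (p x v y : R) :
  1 <= p -> 0 < x -> p <= v * x -> 0 <= y ->
  expR (v * x) * (1 + v * x / p * ((y / x) `^ p - 1)) <= expR (v * y).
Proof.
move=> p1 x0 pvx y0.
have p0 : 0 < p by apply: lt_le_trans p1.
have a1 : 1 <= v * x / p by rewrite ler_pdivlMr// mul1r.
have -> : v * y = v * x + v * x / p * (p * (y / x - 1)).
  by field; rewrite !gt_eqF.
rewrite expRD ler_pM2l ?expR_gt0//.
apply: le_trans (bernoulli_expR _ a1); rewrite lerD2l ler_wpM2l ?(le_trans _ a1)//.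
rewrite lerD2r [p * _]mulrC expRM.
apply: ge0_ler_powR; rewrite ?nnegrE ?divr_ge0 ?expR_ge0 ?(ltW x0) ?(ltW p0)//.
by have := expR_ge1Dx (y / x - 1); rewrite addrC subrK.
Qed.

(** The integral over [D] of [tau^p (e^(v Y / tau) + e^(- v Y / tau))] has expectation at most
    [2 M S], the 2 counting both signs, and is at least [e^(v x) S] on the event; Markov's
    inequality concludes. *)
Lemma Lp_deviation_bound (R : realType) (d : measure_display) (Omega : measurableType d)
    (P : probability Omega R) (D : set R) (Y : R -> Omega -> R) (tau : R -> R)
    (p S eps v x M : R) (mu := @lebesgue_measure R) :
  1 <= p -> 0 < eps -> 0 < S -> 0 < x -> x `^ p = eps / S -> p <= v * x -> 0 <= M ->
  measurable D -> measurable_fun setT tau -> (forall t, D t -> 0 < tau t) ->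
  (\int[mu]_(t in D) (tau t `^ p)%:E = S%:E)%E ->
  measurable_fun (D `*` setT) (fun z : R * Omega => Y z.1 z.2) ->
  (forall t l, D t -> `|l| = v / tau t -> (\int[P]_w (expR (l * Y t w))%:E <= M%:E)%E) ->
  (P [set w | (eps%:E < \int[mu]_(t in D) (`|Y t w| `^ p)%:E)%E]
    <= (2 * M * expR (- (v * x)))%:E)%E.
Proof.
move=> p1 eps0 S0 x0 xp pvx M0 mD mtau tau0 tauS mY hM.
have p0 : 0 < p by apply: lt_le_trans p1.
have v0 : 0 <= v by rewrite -(pmulr_lge0 _ x0) (le_trans _ pvx)// ltW.
pose a := v * x / p.
have a1 : 1 <= a by rewrite /a ler_pdivlMr// mul1r.
(* The parameter [s] is a sign. On [D] the power [-1] of [tau] is its inverse; in this form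
   measurability is that of powers. *)
pose ex (s : R) (z : R * Omega) := expR (s * v * tau z.1 `^ (-1) * Y z.1 z.2).
pose G z := (tau z.1 `^ p * (ex 1 z + ex (-1) z))%:E.
pose A z := (`|Y z.1 z.2| `^ p)%:E.
have mtau1 (D' : set (R * Omega)) : measurable_fun D' (fun z : R * Omega => tau z.1).
  by apply: measurable_funTS; apply: measurableT_comp.
have mpow q (D' : set (R * Omega)) : measurable_fun D' (fun z : R * Omega => tau z.1 `^ q).
  by apply: (measurableT_comp (measurable_powR q)).
have mex s : measurable_fun (D `*` setT) (ex s).
  apply: measurableT_comp => //; apply: measurable_funM => //.
  by apply: measurable_funM => //.
have mG : measurable_fun (D `*` setT) G.
  apply/measurable_EFinP; apply: measurable_funM => //.
  exact: measurable_funD.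
have mA : measurable_fun (D `*` setT) A.
  apply/measurable_EFinP; apply: (measurableT_comp (measurable_powR p)).
  exact: measurableT_comp.
have G0 z : (0 <= G z)%E by rewrite lee_fin mulr_ge0 ?powR_ge0// addr_ge0// expR_ge0.
have A0 z : (0 <= A z)%E by rewrite lee_fin powR_ge0.
have [mGw mIG mJG IGE] := @tonelli_within _ _ _ _ _ mu P D G mD mG G0.
have [mAw mIA _ _] := @tonelli_within _ _ _ _ _ mu P D A mD mA A0.
set E := [set w | _].
have mE : measurable E.
  have := emeasurable_fun_o_infty measurableT mIA eps%:E.
  by rewrite setTI.
have mtaup : measurable_fun D (fun t => (tau t `^ p)%:E).
  apply/measurable_EFinP; apply: (measurableT_comp (measurable_powR p)).
  exact: measurable_funTS.
have EG : (\int[P]_w \int[mu]_(t in D) G (t, w) <= (2 * M * S)%:E)%E.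
  rewrite IGE.
  apply: (@le_trans _ _ (\int[mu]_(t in D) ((2 * M)%:E * (tau t `^ p)%:E))%E).
    apply: ge0_le_integral => //.
    - by move=> t _; apply: integral_ge0.
    - exact: measurable_funeM.
    move=> t Dt; have tt0 := tau0 _ Dt.
    have tauV : tau t `^ (-1) = (tau t)^-1 by rewrite powR_inv1// ltW.
    have exE (s : R) : s ^+ 2 = 1 -> (\int[P]_w (ex s (t, w))%:E <= M%:E)%E.
      move=> s1; rewrite /ex/= tauV.
      apply: (hM _ (s * v * (tau t)^-1)) => //.
      rewrite -mulrA normrM.
      have -> : `|s| = 1 by apply/eqP; rewrite -sqr_norm_eq1 s1.
      by rewrite mul1r ger0_norm// divr_ge0// ltW.
    have mext s : measurable_fun setT (fun w => (ex s (t, w))%:E).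
      apply: (@measurable_comp _ _ _ _ _ _ (D `*` setT) (EFin \o ex s)).
      - exact: measurableX.
      - by move=> _ [w _ <-]; split.
      - exact/measurable_EFinP.
      - exact: pair1_measurable.
    have ex0 s w : (0 <= (ex s (t, w))%:E)%E by rewrite lee_fin expR_ge0.
    rewrite /G/=.
    under eq_integral do rewrite EFinM EFinD.
    rewrite ge0_integralZl//; last 3 first.
    - exact: emeasurable_funD.
    - by move=> w _; rewrite adde_ge0.
    - by rewrite lee_fin powR_ge0.
    rewrite ge0_integralD// muleC lee_wpmul2r ?lee_fin ?powR_ge0//.
    have -> : 2 * M = M + M by ring.
    by rewrite EFinD leeD// exE// ?expr1n// sqrrN expr1n.
  by rewrite ge0_integralZl// ?tauS// ?lee_fin ?mulr_ge0// => t _; rewrite lee_fin powR_ge0.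
have EGE w : E w -> ((expR (v * x) * S)%:E <= \int[mu]_(t in D) G (t, w))%E.
  rewrite /E/= => epsA.
  (* [expR_ge_powR] times [tau^p] gives [c |Y|^p - c' tau^p <= G]. The negative term changes sides
     to keep all integrands nonnegative, as [|Y|^p] may have infinite integral. Note that
     [c eps - c' S = e^(v x) S]. *)
  pose c := expR (v * x) * a * (S / eps).
  pose c' := expR (v * x) * (a - 1).
  have c0 : 0 <= c 
    by rewrite mulr_ge0 ?divr_ge0 ?(ltW S0) ?(ltW eps0)// mulr_ge0 ?expR_ge0// (le_trans _ a1).
  have c'0 : 0 <= c' by rewrite mulr_ge0 ?expR_ge0// subr_ge0.
  have pw t : D t -> (c%:E * A (t, w) <= G (t, w) + c'%:E * (tau t `^ p)%:E)%E.
    move=> Dt; have tt0 := tau0 _ Dt.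
    have tauV : tau t `^ (-1) = (tau t)^-1 by rewrite powR_inv1// ltW.
    have tp0 : 0 < tau t `^ p by rewrite powR_gt0.
    rewrite -!EFinM -EFinD lee_fin /=.
    have y0 : 0 <= `|Y t w| / tau t by rewrite divr_ge0// ltW.
    have := expR_ge_powR p1 x0 pvx y0.
    have -> : (`|Y t w| / tau t / x) `^ p = `|Y t w| `^ p * (tau t `^ p)^-1 * (S / eps).
      rewrite (powR_div _ y0 (ltW x0)) (powR_div _ (normr_ge0 _) (ltW tt0)).
      by rewrite xp invf_div.
    rewrite -/a => hexp.
    have habs : expR (v * (`|Y t w| / tau t)) <= ex 1 (t, w) + ex (-1) (t, w).
      rewrite /ex/= tauV mul1r mulN1r.
      have [Y0|Y0] := leP 0 (Y t w).
        rewrite ger0_norm//; have -> : v * (Y t w / tau t) = v * (tau t)^-1 * Y t w by ring.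
        by rewrite lerDl expR_ge0.
      rewrite ltr0_norm//; have -> : v * (- Y t w / tau t) = - v * (tau t)^-1 * Y t w by ring.
      by rewrite lerDr expR_ge0.
    have H := ler_wpM2l (ltW tp0) (le_trans hexp habs).
    suff -> : c * `|Y t w| `^ p = tau t `^ p * (expR (v * x) *
        (1 + a * (`|Y t w| `^ p * (tau t `^ p)^-1 * (S / eps) - 1))) + c' * tau t `^ p.
      by rewrite lerD2r.
    rewrite /c /c'; move: (tau t `^ p) tp0 (`|Y t w| `^ p) (expR (v * x)) => q q0 yy e.
    clearbody a.
    by field; rewrite !gt_eqF.
  have int_le : (c%:E * \int[mu]_(t in D) A (t, w) <=
      \int[mu]_(t in D) G (t, w) + c'%:E * S%:E)%E.
    have tp0 t : D t -> (0 <= (tau t `^ p)%:E)%E by move=> _; rewrite lee_fin powR_ge0.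
    rewrite -tauS -!ge0_integralZl// ?lee_fin//.
    rewrite -ge0_integralD//; last 2 first.
    - by move=> t Dt; apply: mule_ge0; [rewrite lee_fin|exact: tp0].
    - exact: measurable_funeM.
    apply: ge0_le_integral => //.
    - by move=> t Dt; rewrite mule_ge0 ?lee_fin.
    - exact: measurable_funeM.
    - by apply: emeasurable_funD => //; exact: measurable_funeM.
  have : ((c * eps)%:E <= \int[mu]_(t in D) G (t, w) + c'%:E * S%:E)%E.
    apply: le_trans int_le; rewrite (EFinM c).
    by apply: lee_wpmul2l; [rewrite lee_fin|exact: ltW].
  have : (0 <= \int[mu]_(t in D) G (t, w))%E by apply: integral_ge0.
  have -> : c * eps = expR (v * x) * a * S by rewrite /c; field; rewrite gt_eqF//.
  case: (\int[mu]_(t in D) G (t, w))%E => [r| |]; rewrite ?leey//.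
  rewrite -EFinM -EFinD !lee_fin /c' => _.
  have -> : expR (v * x) * (a - 1) * S = expR (v * x) * a * S - expR (v * x) * S by ring.
  by move: (expR (v * x) * a * S) (expR (v * x) * S) => q1 q2; lra.
have h : ((expR (v * x) * S)%:E * P E <= (2 * M * S)%:E)%E.
  rewrite -(integral_cst P mE); apply: le_trans EG.
  apply: (@le_trans _ _ (\int[P]_(w in E) \int[mu]_(t in D) G (t, w))%E).
    apply: ge0_le_integral => //.
    - by move=> w _; rewrite lee_fin mulr_ge0 ?expR_ge0// ltW.
    - exact: measurable_funTS.
  apply: ge0_subset_integral => //.
  by move=> w _; apply: integral_ge0.
have ES0 : 0 < expR (v * x) * S by rewrite mulr_gt0 ?expR_gt0.
rewrite -(@lee_pmul2l _ (expR (v * x) * S)%:E)// ?lte_fin//.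
apply: (le_trans h); rewrite -EFinM lee_fin expRN.
have := expR_gt0 (v * x); move: (expR (v * x)) => e e0.
rewrite le_eqVlt; apply/orP; left; apply/eqP; field; rewrite gt_eqF//.
Qed.

(** * Legendre transform *)

Section density.
Context (R : realType) (phi f : R -> R) (hf : is_density phi f).

Lemma density_ge0 (v : R) : 0 <= v -> 0 <= f v.
Proof.
move=> v0; have [inc [_ [f0 _]]] := hf.
by rewrite -f0; apply: inc; rewrite // in_itv/= ?lexx ?v0.
Qed.

Lemma phi_ge0 (u : R) : 0 <= phi u.
Proof.
have [_ [_ [_ [_ ->]]]] := hf; apply: Rintegral_ge0 => v /=.
by rewrite in_itv/= => /andP[v0 _]; exact: density_ge0.
Qed.

Lemma density_integrable (b : R) :
  (@lebesgue_measure R).-integrable `[0, b] (EFin \o f).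
Proof.
have [inc _] := hf.
apply: measurable_bounded_integrable; first exact: measurable_itv.
- by rewrite /= lebesgue_measure_itv/=; case: ifP => _; rewrite ?ltry// -EFinB ltry.
- apply: (eq_measurable_fun (fun x : R => f (Num.max 0 x))).
    by move=> x; rewrite inE/= in_itv/= => /andP[x0 _]; rewrite max_r.
  apply: nondecreasing_measurable; first exact: measurable_itv.
  move=> x y xy; apply: inc.
  - by rewrite in_itv/= le_max lexx.
  - by rewrite in_itv/= le_max lexx.
  - by rewrite ge_max !le_max lexx xy orbT.
exists (f b); split; first exact: num_real.
move=> M fM x /=; rewrite in_itv/= => /andP[x0 xb].
rewrite ger0_norm ?density_ge0// (le_trans _ (ltW fM))//.
by apply: inc; rewrite // in_itv/= ?x0 ?(le_trans x0 xb).
Qed.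

Lemma phi_increment_le (v w : R) : 0 <= v -> v <= w -> phi w - phi v <= f w * (w - v).
Proof.
move=> v0 vw; have [inc [_ [_ [_ phiE]]]] := hf.
have w0 := le_trans v0 vw.
have fI := density_integrable w.
rewrite !phiE !ger0_norm// Rintegral_itvB ?bnd_simp//.
have mI : measurable (`]v, w] : set R) by exact: measurable_itv.
have muI : (@lebesgue_measure R `]v, w]%classic = (w - v)%:E)%E.
  rewrite lebesgue_measure_itv/= lte_fin; case: ifPn => [_|]; first by rewrite EFinB.
  by rewrite -leNgt => wv; have -> : w = v; [apply/le_anti; rewrite wv|rewrite subrr].
have fI' : (@lebesgue_measure R).-integrable `]v, w] (EFin \o f).
  apply: integrableS fI => //.
  by move=> x /=; rewrite !in_itv/= => /andP[/ltW vx ->]; rewrite (le_trans v0 vx).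
have cI : (@lebesgue_measure R).-integrable `]v, w] (EFin \o (fun=> f w)).
  apply: measurable_bounded_integrable => //; first by rewrite /= muI ltry.
  by exists `|f w|; split; [exact: num_real|move=> M fM x _ /=; exact: ltW].
apply: (@le_trans _ _ (\int[@lebesgue_measure R]_(x in `]v, w]) f w)).
  apply: le_Rintegral => // x /=; rewrite in_itv/= => /andP[vx xw].
  by apply: inc; rewrite // in_itv/= ?w0 ?(le_trans v0 (ltW vx)).
rewrite Rintegral_cst//.
have -> : fine (@lebesgue_measure R `]v, w]%classic) = w - v by rewrite muI.
exact: lexx.
Qed.

(** By evenness only [y >= 0] matters, and on [[0, v0]] the function [v x - phi v] does not
    decrease, since [f v <= f v0 <= x] there. *)
Lemma young_fenchel_le (x v0 K : R) : (forall u, phi (- u) = phi u) ->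
  0 <= v0 -> f v0 <= x -> (forall v, v0 <= v -> v * x - phi v <= K) ->
  young_fenchel phi x <= K.
Proof.
move=> even v00 fx HK; have x0 : 0 <= x by rewrite (le_trans _ fx)// density_ge0.
apply: ge_sup; first by exists (x * 0 - phi 0), 0.
move=> _ [y _ <-]; rewrite mulrC.
have step1 : y * x - phi y <= `|y| * x - phi `|y|.
  have -> : phi `|y| = phi y by have [_|_] := ler0P y; rewrite ?even.
  by rewrite lerD2r ler_wpM2r// ler_norm.
apply: (le_trans step1).
have [yv|/ltW yv] := leP v0 `|y|; first exact: HK.
apply: le_trans (HK v0 (lexx _)).
have := phi_increment_le (normr_ge0 y) yv.
have : f v0 * (v0 - `|y|) <= x * (v0 - `|y|) by rewrite ler_wpM2r// subr_ge0.
lra.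
Qed.

End density.

(** * The sampling error *)

(** As [sinc] is even, its quotient can be written with a power of [|x|], whose measurability is at
    hand. *)
Lemma measurable_sinc (R : realType) : measurable_fun setT (@sinc R).
Proof.
have -> : @sinc R = fun x => if x == 0 then 1 else sin `|x| * `|x| `^ (-1).
  apply/funext => x; rewrite /sinc; case: eqVneq => // x0.
  rewrite powR_inv1//; have [_|_] := ler0P x => //.
  by rewrite sinN invrN mulrNN.
apply: measurable_fun_ifT => //.
  by apply: measurable_fun_eqr => //.
apply: measurable_funM.
  apply: measurableT_comp => //; apply: continuous_measurable_fun; exact: continuous_sin.
exact: (measurableT_comp (measurable_powR (-1))).
Qed.

Section sampling_error.
Context (R : realType) (om t : R) (n : nat).

(** The error becomes a single linear combination of values of the process, the form required by
    [SSub]: index 0 is the time [t] with coefficient 1, the others are the sampling points. *)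
Definition error_time (i : 'I_(2 * n).+2) : R :=
  if unlift ord0 i is Some j then (j%:R - n%:R) * pi / om else t.

Definition error_coef (i : 'I_(2 * n).+2) : R :=
  if unlift ord0 i is Some j then - sinc (om * (t - (j%:R - n%:R) * pi / om)) else 1.

(** Arbitrary [h] serves both the paths of [X] and the functions [cos (s * lam)] and [sin (s * lam)]
    of the spectral side. *)
Lemma error_sum (h : R -> R) :
  \sum_(i < (2 * n).+2) error_coef i * h (error_time i) =
  h t - sum_sym n (fun k => sinc (om * (t - k * pi / om)) * h (k * pi / om)).
Proof.
rewrite big_ord_recl /error_coef /error_time unlift_none mul1r -sumrN.
by congr (_ + _); apply: eq_bigr => i _; rewrite liftK mulNr.
Qed.

End sampling_error.

Lemma Sub_exp_integrable (R : realType) (d : measure_display) (Omega : measurableType d)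
    (P : probability Omega R) (phi : R -> R) (xi : {RV P >-> R}) :
  Sub P phi xi -> exp_integrable P xi.
Proof.
move=> [_ [a [_ Ha]]]; split; first exact: measurable_funP.
move=> l; apply/integrableP; split.
  apply/measurable_EFinP; apply: measurableT_comp => //.
  by apply: measurable_funM.
have := Ha l; rewrite unlock => h.
under eq_integral do rewrite /= ger0_norm ?expR_ge0//.
by apply: (le_lt_trans h); rewrite ltry.
Qed.

Section sampling_error_moments.
Context (R : realType) (d : measure_display) (Omega : measurableType d).
Context (P : probability Omega R) (X : R -> {RV P >-> R}) (B phi : R -> R) (CX om L z : R).
Context (n : nat).
Context (hL : 0 < L) (hom : L < om) (hz0 : 0 < z) (hz1 : z < 1) (hn0 : (0 < n)%N).
Context (hSSub : SSub phi X CX) (hstat : stationary X B) (hband : bandlimited B L).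

(** Here [amp t ^+ 2 * B 0] is [C_n t / n^2]. *)
Let amp (t : R) := (4 * om * t / (pi ^+ 2 * (1 - z)) +
    4 * (z + 1 + n%:R^-1) / (pi * (1 - z) ^+ 2 * (1 - L / om))) / n%:R.

Lemma trunc_samplingE (t : R) (w : Omega) :
  X t w - trunc_sampling X om n t w =
  \sum_(i < (2 * n).+2) error_coef om t i * X (error_time om t i) w.
Proof. by rewrite (error_sum om t n (fun s => X s w)). Qed.

Lemma error_second_moment_le (t : R) : 0 <= t -> (om * t / pi) ^+ 2 <= z * n%:R ^+ 2 ->
  ('E_P[fun w => ((\sum_(i < (2 * n).+2) error_coef om t i * X (error_time om t i) w) ^+ 2)%R]
    <= (amp t ^+ 2 * B 0)%:E)%E.
Proof.
move=> t0 ut; apply: (second_moment_bandlimited_le hstat hband) => lam lamL.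
rewrite (error_sum om t n (fun s => cos (s * lam))) (error_sum om t n (fun s => sin (s * lam))).
exact: sampling_remainder hL hom hz0 hz1 hn0 t0 ut lamL.
Qed.

(** [SSub] bounds the norm of the error by [CX] times the root of its second moment, hence by
    [CX * (amp t * Num.sqrt (B 0))]. *)
Lemma error_mgf_le (t l : R) : N_function phi -> (forall x, 0 <= phi x) ->
  0 <= t -> (om * t / pi) ^+ 2 <= z * n%:R ^+ 2 -> 0 <= amp t -> 0 <= B 0 ->
  (\int[P]_w (expR (l * (X t w - trunc_sampling X om n t w)))%:E <=
   (expR (phi (CX * (amp t * Num.sqrt (B 0)) * `|l|)))%:E)%E.
Proof.
move=> Nphi phi0 t0 ut amp0 B0.
have [CX0 [XSub tauS]] := hSSub.
under eq_integral do rewrite trunc_samplingE.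
set Y := fun w => \sum_(i < (2 * n).+2) error_coef om t i * X (error_time om t i) w.
have XI s : exp_integrable P (X s) by exact: Sub_exp_integrable (XSub s).
have YI : exp_integrable P Y.
  exact: exp_integrable_sum (fun i => XI (error_time om t i)).
have EY0 : ('E_P[Y] = 0)%E.
  have YI' := exp_integrable_integrable YI.
  rewrite unlock -[LHS]fineK; last exact: integrable_fin_num YI'.
  congr (_%:E); rewrite -[LHS]/(\int[P]_w Y w).
  rewrite (Rintegral_scaled_sum measurableT (index_enum _) (error_coef om t (n:=n))
    (fun i => exp_integrable_integrable (XI (error_time om t i)))).
  apply: big1 => i _; have [/(_ (error_time om t i))] := hstat.
  by rewrite unlock /Rintegral => -> _; rewrite mulr0.
have := @mgf_le_of_tau_norm _ _ _ P phi Y (CX * (amp t * Num.sqrt (B 0))) l Nphi phi0 YI EY0.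
rewrite unlock; apply.
apply: (le_trans (tauS _ (error_time om t (n:=n)) (error_coef om t (n:=n)))).
rewrite lee_fin ler_pM2l//.
have := error_second_moment_le t0 ut.
have e0 : (0 <= 'E_P[fun w => (Y w ^+ 2)%R])%E by apply: expectation_ge0 => w; exact: sqr_ge0.
rewrite -/Y; move: e0; case: ('E_P[fun w => (Y w ^+ 2)%R])%E => [r| |]//=.
rewrite !lee_fin => r0 rle; have -> : amp t * Num.sqrt (B 0) = Num.sqrt (amp t ^+ 2 * B 0).
  by rewrite sqrtrM ?sqr_ge0// sqrtr_sqr ger0_norm.
by rewrite ler_sqrt// mulr_ge0 ?sqr_ge0.
Qed.

End sampling_error_moments.

Lemma measurable_sampling_error (R : realType) (d : measure_display)
    (Omega : measurableType d) (P : probability Omega R) (X : R -> {RV P >-> R})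
    (om T : R) (n : nat) :
  measurable_process X T ->
  measurable_fun (`[0, T] `*` [set: Omega])
    (fun z : R * Omega => X z.1 z.2 - trunc_sampling X om n z.1 z.2).
Proof.
move=> hmeas; apply: measurable_funB => //; apply: measurable_funTS.
rewrite /trunc_sampling; apply: measurable_sum => j.
apply: measurable_funM; last by apply: measurableT_comp.
apply: (measurableT_comp (@measurable_sinc R)).
apply: measurable_funM => //; apply: measurable_funB => //.
Qed.

Lemma young_fenchel0 (R : realType) (phi : R -> R) : (forall u, 0 <= phi u) ->
  young_fenchel phi 0 <= 0.
Proof.
move=> phi0; apply: ge_sup; first by exists (0 * 0 - phi 0), 0.
by move=> _ [y _ <-]; rewrite mul0r sub0r oppr_le0.
Qed.

(** * Reliability of the approximation *)

Theorem theorem4 (R : realType) (d : measure_display) (Omega : measurableType d)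
  (P : probability Omega R)
  (p T eps delta om L z : R) (n : nat)
  (hp : 1 <= p) (hT : 0 < T) (heps : 0 < eps)
  (hdelta0 : 0 < delta) (hdelta1 : delta < 1)
  (hL : 0 < L) (hom : L < om) (hz0 : 0 < z) (hz1 : z < 1)
  (hn0 : (0 < n)%N) (hn : om * T / (pi * Num.sqrt z) <= n%:R)
  (phi f : R -> R)
  (hphi : N_function phi) (hQ : condition_Q phi) (hf : is_density phi f)
  (X : R -> {RV P >-> R}) (CX : R) (B : R -> R)
  (hSSub : SSub phi X CX) (hstat : stationary X B) (hband : bandlimited B L)
  (hmeas : measurable_process X T) :
  let S := S_np CX B om L z T p n in
  S * (f (p * (S / eps) `^ p^-1)) `^ p < eps ->
  expR (- young_fenchel phi ((eps / S) `^ p^-1)) <= delta / 2 ->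
  approximates_Lp P X (trunc_sampling X om n) p T eps delta.
Proof.
move=> S hS hdelta.
have p0 : 0 < p by apply: lt_le_trans hp.
have phi0 := phi_ge0 hf.
have pi0 := pi_gt0 R.
have om0 : 0 < om by apply: lt_trans hom.
have z1' : 0 < 1 - z by rewrite subr_gt0.
have rho1 : 0 < 1 - L / om by rewrite subr_gt0 ltr_pdivrMr// mul1r.
have nR : 0 < n%:R :> R by rewrite ltr0n.
have B0 : 0 <= B 0.
  have [_ /(_ 0 0)] := hstat; rewrite -lee_fin => <-; rewrite addr0.
  by apply: expectation_ge0 => w; rewrite -expr2 sqr_ge0.
pose amp t := 4 * om * t / (pi ^+ 2 * (1 - z)) +
    4 * (z + 1 + n%:R^-1) / (pi * (1 - z) ^+ 2 * (1 - L / om)).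
have c1 : 0 <= 4 * om / (pi ^+ 2 * (1 - z)).
  by rewrite divr_ge0// mulr_ge0 ?exprn_ge0 ?(ltW om0) ?(ltW pi0) ?(ltW z1').
have c2 : 0 < 4 * (z + 1 + n%:R^-1) / (pi * (1 - z) ^+ 2 * (1 - L / om)).
  rewrite divr_gt0//; first by rewrite mulr_gt0// addr_gt0 ?invr_gt0// addr_gt0.
  by rewrite mulr_gt0// mulr_gt0// exprn_gt0.
have ampE t : amp t = 4 * om / (pi ^+ 2 * (1 - z)) * t +
    4 * (z + 1 + n%:R^-1) / (pi * (1 - z) ^+ 2 * (1 - L / om)).
  by rewrite /amp; congr (_ + _); ring.
have amp_gt0 t : 0 <= t -> 0 < amp t.
  by move=> t0; rewrite ampE ltr_wpDl// mulr_ge0.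
have amp_le s t : s <= t -> amp s <= amp t.
  by move=> st; rewrite !ampE lerD2r ler_wpM2l.
have [CX0 _] := hSSub.
have CnE t : 0 <= t -> C_n B om L z n t `^ (p / 2) = (Num.sqrt (B 0) * amp t) `^ p.
  move=> t0; have a0 := ltW (amp_gt0 t t0).
  rewrite /C_n -/(amp t) -[X in X * _](sqr_sqrtr B0) -exprMn.
  rewrite -powR_mulrn ?mulr_ge0 ?sqrtr_ge0// -powRrM.
  by congr (_ `^ _); field.
(* Degenerate case: [S = 0], and [eps / 0 = 0] makes [hdelta] contradictory. *)
have [B00|B0'] := eqVneq (B 0) 0.
  have S0 : S = 0.
    rewrite /S /S_np.
    under eq_Rintegral do rewrite /C_n B00 mul0r powR0 ?mulf_neq0 ?gt_eqF ?invr_gt0//.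
    by rewrite Rintegral_cst ?mul0r ?mulr0//; exact: measurable_itv.
  move: hdelta; rewrite S0 invr0 mulr0 powR0 ?invr_eq0 ?gt_eqF//.
  have : expR 0 <= expR (- young_fenchel phi 0) by rewrite ler_expR oppr_ge0 young_fenchel0.
  rewrite expR0; lra.
have sB0 : 0 < Num.sqrt (B 0) by rewrite sqrtr_gt0 lt_neqAle eq_sym B0' B0.
pose g t := Num.sqrt (B 0) * amp t.
have g_gt0 t : 0 <= t -> 0 < g t by move=> t0; rewrite mulr_gt0// amp_gt0.
have g_le s t : s <= t -> g s <= g t by move=> st; rewrite ler_pM2l// amp_le.
pose k := CX / n%:R; have k0 : 0 < k by rewrite divr_gt0.
(* For [t >= 0] this is [CX / n] times the root of [C_n t], the bound on the norm of the error at
   [t]; [S] is the integral of its [p]-th power. *)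
pose tau t := k * g t.
have tau_gt0 t : 0 <= t -> 0 < tau t by move=> t0; rewrite mulr_gt0// g_gt0.
have mD : measurable (`[0, T] : set R) by exact: measurable_itv.
(* [lebesgue_measure] lives on [measurableTypeR R], whose display differs from that of [R]. *)
have mD' : measurable (`[0, T]%classic : set (measurableTypeR R)) by exact: mD.
have muD : (@lebesgue_measure R `[0%R, T]%classic = T%:E)%E.
  by rewrite lebesgue_measure_itv/= lte_fin hT -EFinB subr0.
have mg : measurable_fun setT g.
  apply: measurable_funM => //; rewrite (funext ampE).
  by apply: measurable_funD => //; apply: measurable_funM.
have mtau : measurable_fun setT tau by apply: measurable_funM.
have gI : (@lebesgue_measure R).-integrable `[0, T] (EFin \o (fun t => g t `^ p)).
  apply: measurable_bounded_integrable => //; first by rewrite /= muD ltry.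
    by apply: measurable_funTS; apply: (measurableT_comp (measurable_powR p)).
  exists (g T `^ p); split; first exact: num_real.
  move=> M TM t /=; rewrite in_itv/= => /andP[t0 tT].
  rewrite ger0_norm ?powR_ge0// (le_trans _ (ltW TM))//.
  by apply: ge0_ler_powR; rewrite ?nnegrE ?(ltW p0) ?(ltW (g_gt0 _ _)) ?g_le// ltW.
have tauE : {in `[0, T]%classic, (fun t => tau t `^ p) =1 (fun t => k `^ p * g t `^ p)}.
  move=> t; rewrite inE/= in_itv/= => /andP[t0 _].
  by rewrite -powRM ?(ltW k0) ?(ltW (g_gt0 _ _)).
have SE : \int[@lebesgue_measure R]_(t in `[0, T]) (tau t `^ p) = S.
  transitivity (\int[@lebesgue_measure R]_(t in `[0, T]) (k `^ p * g t `^ p)).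
    by apply: eq_Rintegral; exact: tauE.
  rewrite (RintegralZl _ mD' gI); congr (_ * _).
  apply: eq_Rintegral => t; rewrite inE/= in_itv/= => /andP[t0 _].
  by rewrite CnE.
have tauI : (@lebesgue_measure R).-integrable `[0, T] (EFin \o (fun t => tau t `^ p)).
  apply: (eq_integrable mD' _ _ _ (integrableZl mD' (k `^ p) gI)).
  by move=> t tD /=; rewrite tauE.
have S0 : 0 < S.
  rewrite -SE.
  apply: (@lt_le_trans _ _ (\int[@lebesgue_measure R]_(t in `[0, T]) (tau 0 `^ p))).
    rewrite Rintegral_cst//= muD/= mulr_gt0// powR_gt0// tau_gt0//.
  apply: le_Rintegral => //.
    apply: measurable_bounded_integrable => //; first by rewrite /= muD ltry.
    by exists `|tau 0 `^ p|; split; [exact: num_real|move=> M fM x _ /=; exact: ltW].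
  move=> t /=; rewrite in_itv/= => /andP[t0 tT].
  by apply: ge0_ler_powR; rewrite ?nnegrE ?(ltW p0) ?(ltW (tau_gt0 _ _))// ler_pM2l// g_le.
(* With this [x] the first hypothesis reads [S f(p / x)^p < S x^p], that is, [f (p / x) < x]. *)
pose x := (eps / S) `^ p^-1.
have x0 : 0 < x by rewrite powR_gt0// divr_gt0.
have xp : x `^ p = eps / S by rewrite -powRrM mulVf ?gt_eqF// powRr1// ltW// divr_gt0.
have v0E : p * (S / eps) `^ p^-1 = p / x.
  by rewrite /x !powR_div ?(ltW S0) ?(ltW heps)// invf_div.
rewrite v0E in hS; rewrite -/x in hdelta.
have v00 : 0 <= p / x by rewrite divr_ge0// ltW.
have fx : f (p / x) <= x.
  rewrite leNgt; apply/negP => xf.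
  have := gt0_ltr_powR p0; move=> /(_ x (f (p / x))).
  rewrite !nnegrE (ltW x0) (density_ge0 hf v00) => /(_ isT isT xf).
  by rewrite xp ltr_pdivrMr// mulrC => /(lt_trans hS); rewrite ltxx.
pose E := [set w | (eps%:E < \int[@lebesgue_measure R]_(t in `[0%R, T])
   (`|X t w - trunc_sampling X om n t w| `^ p)%:E)%E].
have ut t : `[0, T]%classic t -> (om * t / pi) ^+ 2 <= z * n%:R ^+ 2.
  rewrite /= in_itv/= => /andP[t0 tT].
  have sz : 0 < Num.sqrt z by rewrite sqrtr_gt0.
  have h : om * t / pi <= Num.sqrt z * n%:R.
    apply: (@le_trans _ _ (om * T / pi)).
      by rewrite ler_pM2r ?invr_gt0// ler_pM2l.
    move: hn; rewrite !ler_pdivrMr ?mulr_gt0// => /le_trans; apply.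
    by rewrite le_eqVlt; apply/orP; left; apply/eqP; ring.
  have u0 : 0 <= om * t / pi by rewrite divr_ge0 ?(ltW pi0)// mulr_ge0// ltW.
  have r0 : 0 <= Num.sqrt z * n%:R by rewrite mulr_ge0.
  by rewrite -(sqr_sqrtr (ltW hz0)) -exprMn lerXn2r.
(* At [|l| = v / tau t] the exponential moment is at most [expR (phi v)], whatever [t]; this is the
   [M] of [Lp_deviation_bound]. *)
have PE v : p / x <= v -> (P E <= (2 * expR (phi v) * expR (- (v * x)))%:E)%E.
  move=> v0.
  have vx : p <= v * x by rewrite -ler_pdivrMr.
  apply: (Lp_deviation_bound (Y := fun t w => X t w - trunc_sampling X om n t w) (D := `[0, T]%classic)
    hp heps S0 x0 xp vx (expR_ge0 _) mD mtau).
  - by move=> t /=; rewrite in_itv/= => /andP[t0 _]; exact: tau_gt0.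
  - rewrite -SE -[LHS]fineK//; exact: integrable_fin_num tauI.
  - exact: measurable_sampling_error.
  move=> t l Dt lE; have := Dt; rewrite /= in_itv/= => /andP[t0 _].
  have amp0 : 0 <= amp t / n%:R by rewrite divr_ge0// ltW// amp_gt0.
  have := error_mgf_le hL hom hz0 hz1 hn0 hSSub hstat hband l hphi phi0 t0 (ut t Dt) amp0 B0.
  have -> : CX * (amp t / n%:R * Num.sqrt (B 0)) * `|l| = v.
    rewrite lE (_ : CX * _ = tau t); last by rewrite /tau /g /k; ring.
    by rewrite mulrC divfK// gt_eqF// tau_gt0.
  exact.
(* By contradiction: [P E > delta > 0] has a logarithm, so the bounds for all [v >= p / x] pass to
   the supremum and give [young_fenchel phi x <= - ln (P E / 2)], against [hdelta]. *)
rewrite /approximates_Lp -/E leNgt; apply/negP => dE.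
have PEfin : P E \is a fin_num.
  rewrite ge0_fin_numE//; apply: (le_lt_trans (PE (p / x) (lexx _))); exact: ltry.
move: dE PE; rewrite -(fineK PEfin) lte_fin; set r := fine _ => dr PE.
have r0 : 0 < r by apply: lt_trans dr.
have : young_fenchel phi x <= - ln (r / 2).
  apply: (young_fenchel_le hf _ v00 fx); first by have [_ []] := hphi.
  move=> v /PE; rewrite lee_fin => h.
  have : r / 2 <= expR (phi v - v * x) by rewrite expRD; lra.
  rewrite -{1}(@lnK _ (r / 2)) ?posrE ?divr_gt0// ler_expR; lra.
rewrite -lerN2 opprK -ler_expR lnK ?posrE ?divr_gt0//; lra.
Qed.
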